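(* Let $n\ge 1$, let $G=\mathrm{PU}(n)$, and let $F$ be a closed abelian subgroup of $G$ with $\dim\mathfrak g_0^{F}=\dim F$, where $\mathfrak g_0$ is the Lie algebra of $G$. Then there exist an integer $s\ge 0$ and positive integers $n_1\ge n_2\ge\dots\ge n_s\ge 2$ with $n_{i+1}\mid n_i$ for $1\le i\le s-1$ and $n_1n_2\cdots n_s\mid n$ such that, up to conjugation in $G$, $F$ admits a (direct product) decomposition $$F=H_{n_1}\times\cdots\times H_{n_s}\times T,$$ where $T\subset \mathrm{PU}(m)$ is a torus of dimension $m-1$ and $m=\frac{n}{n_1n_2\cdots n_s}$. Moreover, the conjugacy class of $F$ is uniquely determined by the integers $(n_1,\dots,n_s)$: any two closed abelian subgroups $F',F''$ of $G$ satisfying $\dim\mathfrak g_0^{F'}=\dim F'$ and $\dim\mathfrak g_0^{F''}=\dim F''$ and admitting such a decomposition with the same integers $(n_1,\dots,n_s)$ are conjugate in $G$.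
   Context: $\mathrm{PU}(n)=\mathrm U(n)/\mathrm Z_n$, where $\mathrm Z_n=\{\lambda I_n:|\lambda|=1\}$; $[A]$ denotes the class of $A$. A closed subgroup $F$ acts on $\mathfrak g_0$ by the adjoint action, $\mathfrak g_0^F$ is the space of fixed vectors, and $\dim F$ is the dimension of $F$ as a Lie group. For $k\ge1$ put $\omega_k=e^{2\pi i/k}$ and let $H_k\subset \mathrm{PU}(k)$ be the subgroup generated by $[\mathrm{diag}\{1,\omega_k,\dots,\omega_k^{k-1}\}]$ and the class of the cyclic permutation matrix with entries $1$ in positions $(i,i+1)$, $1\le i\le k-1$, and $(k,1)$. The product $H_{n_1}\times\cdots\times H_{n_s}\times T$ is viewed as a subgroup of $\mathrm{PU}(n)$ through the tensor product $\mathbb C^n=\mathbb C^{n_1}\otimes\cdots\otimes\mathbb C^{n_s}\otimes\mathbb C^m$, i.e. $([A_1],\dots,[A_s],[B])\mapsto[A_1\otimes\cdots\otimes A_s\otimes B]$. When $s=0$ the product $n_1\cdots n_s$ is $1$ and $F=T$. *)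

(* Defs.v *)
From HB Require Import structures.
From mathcomp Require Import all_boot all_order all_algebra.
From mathcomp Require Import all_classical all_reals all_analysis.
From mathcomp Require Import perm complex mxtens.

Set Implicit Arguments.
Unset Strict Implicit.
Unset Printing Implicit Defensive.

Import Order.TTheory GRing.Theory Num.Theory.
Import numFieldNormedType.Exports.

Local Open Scope classical_set_scope.
Local Open Scope complex_scope.
Local Open Scope sesquilinear_scope.
Local Open Scope quotient_scope.
Local Open Scope ring_scope.

(* Declaring the codomain to be a numClosedFieldType gives Cplx R the norm
   topology that every numFieldType carries; R[i] itself has no topology. *)
Definition Cplx (R : realType) : numClosedFieldType := R[i].

Definition toC (R : realType) (x : R) : Cplx R := x%:C.

Section UnitaryGroup.
Variables (R : realType) (n : nat).
Local Notation C := (Cplx R).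

Record unitary := Unitary {umx :> 'M[C]_n; umxP : umx \is unitarymx}.

HB.instance Definition _ := [isSub for umx].
HB.instance Definition _ := [Choice of unitary by <:].
HB.instance Definition _ :=
  Topological.copy unitary (initial_topology (umx : unitary -> 'M[C]_n)).

Fact unitary1_subproof : (1%:M : 'M[C]_n) \is unitarymx.
Proof. by apply/unitarymxP; rewrite trmx1 map_mx1 mulmx1. Qed.

Fact unitaryM_subproof (A B : unitary) : umx A *m umx B \is unitarymx.
Proof. by apply: mul_unitarymx; exact: umxP. Qed.

Fact unitaryV_subproof (A : unitary) : (umx A)^t* \is unitarymx.
Proof. by rewrite trmxC_unitary; exact: umxP. Qed.

Definition unitary1 := Unitary unitary1_subproof.
Definition unitaryM A B := Unitary (unitaryM_subproof A B).
Definition unitaryV A := Unitary (unitaryV_subproof A).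

Fact unitaryMA : associative unitaryM.
Proof. by move=> x y z; apply: val_inj; rewrite /= mulmxA. Qed.

Fact unitary1M : left_id unitary1 unitaryM.
Proof. by move=> x; apply: val_inj; rewrite /= mul1mx. Qed.

Fact unitaryM1 : right_id unitary1 unitaryM.
Proof. by move=> x; apply: val_inj; rewrite /= mulmx1. Qed.

Fact unitaryMV : right_inverse unitary1 unitaryV unitaryM.
Proof. by move=> x; apply: val_inj; exact/unitarymxP/umxP. Qed.

Fact unitaryVM : left_inverse unitary1 unitaryV unitaryM.
Proof.
move=> x; apply: val_inj => /=; apply: mulmx1C.
exact/unitarymxP/umxP.
Qed.

HB.instance Definition _ := isGroup.Build unitary
  unitaryMA unitary1M unitaryM1 unitaryVM unitaryMV.

Definition proj_eq (A B : unitary) : bool :=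
  `[< exists2 l : C, `|l| = 1 & umx A = l *: umx B >].

Fact proj_eq_equiv : equiv_class_of proj_eq.
Proof.
split.
- by move=> A; apply/asboolP; exists 1; rewrite ?normr1 ?scale1r.
- suff sym A B : proj_eq A B -> proj_eq B A.
    by move=> A B; apply/idP/idP; exact: sym.
  move=> /asboolP[l l1 AlB]; apply/asboolP; exists l^-1.
    by rewrite normfV l1 invr1.
  by rewrite AlB scalerA mulVf ?scale1r// -normr_eq0 l1 oner_eq0.
- move=> B A D /asboolP[k k1 AkB] /asboolP[l l1 BlD]; apply/asboolP.
  by exists (k * l); rewrite ?normrM ?k1 ?l1 ?mulr1// AkB BlD scalerA.
Qed.

Canonical proj_eq_equivRel := EquivRelPack proj_eq_equiv.

Definition PU := {eq_quot proj_eq}.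

HB.instance Definition _ :=
  Topological.copy PU (quotient_topology {eq_quot proj_eq}).
HB.instance Definition _ := Quotient.copy PU {eq_quot proj_eq}.

Definition pcl (A : unitary) : PU := \pi A.

Fact pclE A B : pcl A = pcl B <->
  exists2 l : C, `|l| = 1 & umx A = l *: umx B.
Proof.
change (\pi_{eq_quot proj_eq} A = \pi_{eq_quot proj_eq} B <->
  exists2 l : C, `|l| = 1 & umx A = l *: umx B).
by split=> [/eqmodP/asboolP|AB] //; apply/eqmodP/asboolP.
Qed.

Definition PU1 : PU := pcl unitary1.
Definition PUM (x y : PU) : PU := pcl (unitaryM (repr x) (repr y)).
Definition PUV (x : PU) : PU := pcl (unitaryV (repr x)).

Fact PUME A B : PUM (pcl A) (pcl B) = pcl (unitaryM A B).
Proof.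
have [k k1 ek] := (pclE (repr (pcl A)) A).1 (reprK _).
have [l l1 el] := (pclE (repr (pcl B)) B).1 (reprK _).
apply/pclE; exists (k * l); first by rewrite normrM k1 l1 mulr1.
by rewrite /= ek el -scalemxAl -scalemxAr scalerA.
Qed.

Fact PUVE A : PUV (pcl A) = pcl (unitaryV A).
Proof.
have [k k1 ek] := (pclE (repr (pcl A)) A).1 (reprK _).
apply/pclE; exists (k^*)%R; first by rewrite norm_conjC.
by rewrite /= ek linearZ/= map_mxZ.
Qed.

Fact PU_ind (P : PU -> Prop) : (forall A, P (pcl A)) -> forall x, P x.
Proof. by move=> h x; rewrite -[x]reprK; exact: h. Qed.

Fact PUMA : associative PUM.
Proof.
by elim/PU_ind => x; elim/PU_ind => y; elim/PU_ind => z;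
  rewrite !PUME unitaryMA.
Qed.

Fact PU1M : left_id PU1 PUM.
Proof. by elim/PU_ind => x; rewrite PUME unitary1M. Qed.

Fact PUM1 : right_id PU1 PUM.
Proof. by elim/PU_ind => x; rewrite PUME unitaryM1. Qed.

Fact PUVM : left_inverse PU1 PUV PUM.
Proof. by elim/PU_ind => x; rewrite PUVE PUME unitaryVM. Qed.

Fact PUMV : right_inverse PU1 PUV PUM.
Proof. by elim/PU_ind => x; rewrite PUVE PUME unitaryMV. Qed.

HB.instance Definition _ := isGroup.Build PU PUMA PU1M PUM1 PUVM PUMV.

End UnitaryGroup.

Section Subgroups.
Variable G : groupType.

Definition is_subgroup (S : set G) : Prop :=
  S 1%g /\ forall x y, S x -> S y -> S (x / y)%g.

Definition is_abelian (S : set G) : Prop :=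
  forall x y, S x -> S y -> commute x y.

Definition generated (S : set G) : set G := smallest is_subgroup S.

Definition conj_set (g : G) (S : set G) : set G :=
  [set (g * x * g^-1)%g | x in S].

End Subgroups.

Section LieAlgebra.
Variables (R : realType) (n : nat).
Local Notation C := (Cplx R).
Implicit Types (F : set (PU R n)) (X : 'M[C]_n).

Definition expmx X : 'M[C]_n :=
  lim (series (fun k => (k`!%:R)^-1 *: X ^+ k) @ \oo).

(* The Lie algebra of PU(n) is u(n) modulo the scalar matrices; it is realised
   as the complement su(n), equivariantly for the adjoint action and with
   exponential map X |-> [expmx X]. *)
Definition lie_PU : set 'M[C]_n := [set X | X^t* = - X /\ \tr X = 0].

(* Independent of the representative, since unit scalars cancel. *)
Definition Ad (x : PU R n) X : 'M[C]_n :=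
  umx (repr x) *m X *m (umx (repr x))^t*.

Definition lie_fixed F : set 'M[C]_n :=
  lie_PU `&` [set X | forall x, F x -> Ad x X = X].

(* The Lie algebra of a closed subgroup F, in the sense of Cartan's theorem. *)
Definition lie_sub F : set 'M[C]_n :=
  lie_PU `&` [set X | forall t : R,
    exists2 A : unitary R n, umx A = expmx (toC t *: X) & F (pcl A)].

(* B is a basis of V over the reals. *)
Definition has_real_dim (V : set 'M[C]_n) (d : nat) : Prop :=
  exists B : 'I_d -> 'M[C]_n,
    V = [set X | exists c : 'I_d -> R, X = \sum_i toC (c i) *: B i] /\
    forall c : 'I_d -> R, \sum_i toC (c i) *: B i = 0 -> forall i, c i = 0.

(* dim g_0^F = dim F, where dim F is the dimension of the Lie algebra of F. *)
Definition dim_fixed_eq_dim F : Prop :=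
  exists d, has_real_dim (lie_fixed F) d /\ has_real_dim (lie_sub F) d.

Definition closed_abelian_subgroup F : Prop :=
  [/\ closed F, is_subgroup F & is_abelian F].

End LieAlgebra.

Section Torus.
Variables (R : realType) (m : nat).
Local Notation C := (Cplx R).

(* The points of U(1)^d, as row vectors multiplied entrywise. *)
Definition circles d : set 'rV[C]_d := [set z | forall j, `|z ord0 j| = 1].
Arguments circles : clear implicits.

(* T is isomorphic to U(1)^d as a topological group: U(1)^d is compact and PU(m)
   is Hausdorff, so a continuous bijection f from U(1)^d to T is automatically
   a homeomorphism. *)
Definition is_torus (d : nat) (T : set (PU R m)) : Prop :=
  exists f : 'rV[C]_d -> PU R m,
    [/\ {within circles d, continuous f},
        forall z w, circles d z -> circles d w ->
          f (map2_mx *%R z w) = (f z * f w)%g,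
        set_inj (circles d) f
      & f @` circles d = T].

End Torus.

Section Heisenberg.
Variables (R : realType) (k : nat).
Local Notation C := (Cplx R).

Definition omega : C :=
  Complex (cos (2 * pi / k%:R : R)) (sin (2 * pi / k%:R : R)).

Fact omega_norm : `|omega| = 1.
Proof.
by rewrite normc_def /= cos2Dsin2 sqrtr1.
Qed.

Definition clock_mx : 'M[C]_k := diag_mx (\row_(j < k) omega ^+ j).

Definition shift_mx : 'M[C]_k := \matrix_(i, j) (ordS i == j)%:R.

Fact clock_mxP : clock_mx \is unitarymx.
Proof.
apply/unitarymxP; rewrite /clock_mx tr_diag_mx map_diag_mx mulmx_diag.
apply/matrixP => i j; rewrite !mxE -normCK normrX omega_norm !expr1n.
by case: eqP.
Qed.

Fact shift_mxP : shift_mx \is unitarymx.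
Proof.
have -> : shift_mx = perm_mx (perm (@ordS_inj k)).
  by apply/matrixP => i j; rewrite !mxE permE.
apply/unitarymxP; rewrite tr_perm_mx map_perm_mx -perm_mxM.
by rewrite mulgV perm_mx1.
Qed.

Definition Hgroup : set (PU R k) :=
  generated [set pcl (Unitary clock_mxP); pcl (Unitary shift_mxP)].

End Heisenberg.
Arguments Hgroup : clear implicits.

Section Tensor.
Variable R : realType.

Fact tens_unitary_subproof a b (A : unitary R a) (B : unitary R b) :
  umx A *t umx B \is unitarymx.
Proof.
apply/unitarymxP; rewrite trmx_tens map_mxT tensmx_mul.
rewrite (elimT unitarymxP (umxP A)) (elimT unitarymxP (umxP B)).
apply/matrixP => i j; case: (mxtens_indexP i) => i1 i2.
case: (mxtens_indexP j) => j1 j2.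
by rewrite tensmxE !mxE (can_eq (@mxtens_indexK _ _)) -natrM mulnb.
Qed.

Definition tensU a b (A : unitary R a) (B : unitary R b) : unitary R (a * b)%N :=
  Unitary (tens_unitary_subproof A B).

Definition tensPU a b (x : PU R a) (y : PU R b) : PU R (a * b)%N :=
  pcl (tensU (repr x) (repr y)).

Fact tensPUE a b (A : unitary R a) (B : unitary R b) :
  tensPU (pcl A) (pcl B) = pcl (tensU A B).
Proof.
have [k k1 ek] := (pclE (repr (pcl A)) A).1 (reprK _).
have [l l1 el] := (pclE (repr (pcl B)) B).1 (reprK _).
apply/pclE; exists (k * l); first by rewrite normrM k1 l1 mulr1.
by rewrite /= ek el; apply/matrixP => i j; rewrite !mxE mulrACA.
Qed.

Variable m : nat.

Fixpoint tens_dim (ns : seq nat) : nat :=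
  if ns is k :: ns' then (k * tens_dim ns')%N else m.

Fixpoint PUprod (ns : seq nat) : Type :=
  if ns is k :: ns' then (PU R k * PUprod ns')%type else PU R m.

Fixpoint tens_map (ns : seq nat) : PUprod ns -> PU R (tens_dim ns) :=
  if ns is k :: ns' then fun x => tensPU x.1 (tens_map x.2) else id.

Fixpoint HTprod (ns : seq nat) (T : set (PU R m)) : set (PUprod ns) :=
  if ns is k :: ns' return set (PUprod ns)
  then Hgroup R k `*` @HTprod ns' T else T.

End Tensor.
Arguments tens_map {R m ns}.
Arguments HTprod {R m} ns T.

Definition castPU (R : realType) (a b : nat) (e : a = b) (x : PU R a) :
  PU R b := ecast k (PU R k) e x.

Definition admissible (n : nat) (ns : seq nat) : Prop :=
  [/\ all (leq 2) ns, sorted geq ns, sorted (fun a b => b %| a)%N ns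
    & (\prod_(k <- ns) k %| n)%N].

(* Conjugation is taken after identifying the tensor product of the factors with
   C^n through the equality e of dimensions.  The injectivity clause says that
   the decomposition is a direct product. *)
Definition has_decomposition (R : realType) (n : nat) (ns : seq nat)
    (F : set (PU R n)) : Prop :=
  let m := (n %/ \prod_(k <- ns) k)%N in
  exists (e : tens_dim m ns = n) (T : set (PU R m)) (g : PU R n),
    [/\ is_torus m.-1 T,
        set_inj (HTprod ns T) tens_map
      & conj_set g F = [set castPU e (tens_map x) | x in HTprod ns T]].

(* Main.v *)
Require Import Defs.
From mathcomp Require Import all_boot all_order all_algebra.
From mathcomp Require Import all_classical all_reals all_analysis.
From mathcomp Require Import complex mxtens ring lra.

Set Implicit Arguments.
Unset Strict Implicit.
Unset Printing Implicit Defensive.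

Import Order.TTheory GRing.Theory Num.Theory.
Import numFieldNormedType.Exports.

Local Open Scope classical_set_scope.
Local Open Scope sesquilinear_scope.
Local Open Scope ring_scope.

(** The proof passes from F to its preimage S in U(n) and works with matrices.

    Since F is abelian, the Lie algebra of F lies in the space of F-fixed
    vectors; equal dimensions make the two spaces equal ([lie_sub_fixed],
    [real_dim_subset_eq]).  A unitary matrix centralising S is, up to a scalar,
    the exponential of a fixed vector, so it lies in S.  Hence S is a group
    whose commutators are scalars, in fact n-th roots of unity, and which
    contains every unitary matrix centralising it ([heis_lifts]).  The rest is
    about such groups.

    The commutator is a bimultiplicative pairing on S with values in the roots
    of unity.  If k is its exponent, some pair x, y in S has a primitive k-th
    root of unity as commutator ([primitive_commutator]).  The centre of S is
    divisible, because roots of a unitary matrix can be taken inside the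
    functions of that matrix; so x and y can be corrected to have x^k = y^k = 1
    and commutator exactly omega ([split_order]).  Such a pair is a multiple of
    the standard clock and shift pair ([clock_shift_rep]), and therefore
    C^n = C^k (x) C^p with x and y acting on the first factor.  Every s in S can
    be multiplied by powers of x and y so as to commute with both, and then it
    acts on the second factor only; so S is the tensor product of the group of
    the clock and shift pair and of a group of the same type in U(p)
    ([heis_tensor]).  The commutators of the latter are again k-th roots of
    unity, which gives the divisibility chain n_(i+1) | n_i by induction on n.
    When k = 1 the group is commutative and is a full diagonal torus in some
    orthonormal basis ([comm_heis_diag]).  This proves existence
    ([heis_structure]).

    For uniqueness, let S be the tensor product of clock and shift groups with
    the preimage of a torus T in PU(m).  A torus is divisible and commutators
    of lifts are m-th roots of unity, so the lifts of T commute
    ([torus_lifts_commute]).  They inherit from S the property of containing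
    every unitary matrix centralising them ([tens_set_centre]), and hence form
    a full diagonal torus in some orthonormal basis.  So S is conjugate to a
    standard model determined by the n_i ([decomposition_standard]). *)

(** * Unitary matrices and the spectral theorem *)

Section UnitaryMatrices.
Variable C : numClosedFieldType.

Lemma adjmxM m n p (A : 'M[C]_(m, n)) (B : 'M[C]_(n, p)) :
  (A *m B)^t* = B^t* *m A^t*.
Proof. by rewrite trmx_mul map_mxM. Qed.

Lemma mxpowS n (A : 'M[C]_n) k : A ^+ k.+1 = A *m A ^+ k.
Proof. exact: exprS. Qed.

Lemma mxpowSr n (A : 'M[C]_n) k : A ^+ k.+1 = A ^+ k *m A.
Proof. exact: exprSr. Qed.

Lemma mxpowD n (A : 'M[C]_n) k l : A ^+ (k + l) = A ^+ k *m A ^+ l.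
Proof. exact: exprD. Qed.

Lemma adjmxX n (A : 'M[C]_n) k : (A ^+ k)^t* = (A^t*) ^+ k.
Proof.
elim: k => [|k IH]; first by rewrite !expr0 trmx1 map_mx1.
by rewrite mxpowSr mxpowS adjmxM IH.
Qed.

Lemma adjmxZ m n (c : C) (A : 'M[C]_(m, n)) : (c *: A)^t* = c^* *: A^t*.
Proof. by apply/matrixP=> i j; rewrite !mxE rmorphM. Qed.

Lemma mulmx_scale_mid m n p q (c : C) (A : 'M[C]_(m, n)) (B : 'M[C]_(n, p))
  (D : 'M[C]_(p, q)) : A *m (c *: B) *m D = c *: (A *m B *m D).
Proof. by rewrite -scalemxAr -scalemxAl. Qed.

Lemma adj_diag_mx n (d : 'rV[C]_n) : (diag_mx d)^t* = diag_mx (map_mx Num.conj d).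
Proof. by rewrite tr_diag_mx map_diag_mx. Qed.

Lemma unitary_adjmxK n (u : 'M[C]_n) : u \is unitarymx -> u *m u^t* = 1%:M.
Proof. by move/unitarymxP. Qed.

Lemma unitary_adjKmx n (u : 'M[C]_n) : u \is unitarymx -> u^t* *m u = 1%:M.
Proof. by move/unitarymxP/mulmx1C. Qed.

Lemma scale_unitarymx n (c : C) (u : 'M[C]_n) :
  `|c| = 1 -> u \is unitarymx -> c *: u \is unitarymx.
Proof.
move=> c1 /unitarymxP uu; apply/unitarymxP.
rewrite adjmxZ -scalemxAl -scalemxAr scalerA uu.
by rewrite -normCK c1 expr1n scale1r.
Qed.

Lemma diag_mx_unitaryP n (d : 'rV[C]_n) :
  (diag_mx d \is unitarymx) <-> (forall i, `|d 0 i| = 1).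
Proof.
split=> [/unitarymxP|h].
  rewrite adj_diag_mx mulmx_diag => /matrixP h i; move: (h i i).
  rewrite !mxE eqxx mulr1n -normCK => /eqP.
  by rewrite sqrp_eq1 ?normr_ge0// => /eqP.
apply/unitarymxP; rewrite adj_diag_mx mulmx_diag.
by apply/matrixP => i j; rewrite !mxE -normCK h expr1n.
Qed.

(** Functional calculus in disguise: the hypothesis says that f is a function
    of the eigenvalues d, so diag f is a polynomial in diag d. *)
Lemma comm_spectral_fun n (P B : 'M[C]_n) (d f : 'rV[C]_n) :
  P \is unitarymx -> (forall i j, d 0 i = d 0 j -> f 0 i = f 0 j) ->
  comm_mx B (P^t* *m diag_mx d *m P) -> comm_mx B (P^t* *m diag_mx f *m P).
Proof.
move=> Pu df.
have red (g : 'rV[C]_n) : comm_mx B (P^t* *m diag_mx g *m P) <->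
    comm_mx (P *m B *m P^t*) (diag_mx g).
  have PP := unitary_adjmxK Pu; have PP' := unitary_adjKmx Pu.
  have e1 : P *m B *m P^t* *m diag_mx g =
      P *m (B *m (P^t* *m diag_mx g *m P)) *m P^t*.
    by rewrite -!mulmxA PP mulmx1.
  have e2 : diag_mx g *m (P *m B *m P^t*) =
      P *m ((P^t* *m diag_mx g *m P) *m B) *m P^t*.
    by rewrite !mulmxA PP mul1mx.
  rewrite /comm_mx e1 e2; split=> [->//|h].
  have := congr1 (fun X => P^t* *m X *m P) h.
  by rewrite !mulmxA PP' !mul1mx -!mulmxA PP' !mulmx1 !mulmxA.
rewrite !red; set B' := _ *m _ *m _ => /matrixP h.
apply/matrixP=> i j; move: (h i j); rewrite !mul_mx_diag !mul_diag_mx !mxE.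
move=> /eqP; rewrite [X in _ == X]mulrC -subr_eq0 -mulrBr mulf_eq0.
case/orP=> [/eqP ->|]; first by rewrite mul0r mulr0.
by rewrite subr_eq0 => /eqP/df ->; rewrite mulrC.
Qed.

Lemma unitary_normalmx n (u : 'M[C]_n) : u \is unitarymx -> u \is normalmx.
Proof.
by move=> uu; apply/normalmxP; rewrite unitary_adjmxK ?unitary_adjKmx.
Qed.

Lemma normal_spectral n (A : 'M[C]_n) : A \is normalmx ->
  exists P : 'M[C]_n, P \is unitarymx /\
  exists d : 'rV_n, A = P^t* *m diag_mx d *m P.
Proof.
move=> /orthomx_spectralP An; exists (spectralmx A).
split; first exact: spectral_unitarymx.
by exists (spectral_diag A); rewrite -invmx_unitary ?spectral_unitarymx.
Qed.

Lemma conj_diagK n (P : 'M[C]_n) (d : 'rV[C]_n) : P \is unitarymx ->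
  P *m (P^t* *m diag_mx d *m P) *m P^t* = diag_mx d.
Proof.
move=> Pu; rewrite !mulmxA unitary_adjmxK// mul1mx -mulmxA unitary_adjmxK//.
by rewrite mulmx1.
Qed.

Lemma conj_diag_unitaryP n (P : 'M[C]_n) (d : 'rV[C]_n) : P \is unitarymx ->
  (P^t* *m diag_mx d *m P \is unitarymx) <-> (forall i, `|d 0 i| = 1).
Proof.
move=> Pu; rewrite -diag_mx_unitaryP; split=> h.
  rewrite -(conj_diagK d Pu); apply: mul_unitarymx; last by rewrite trmxC_unitary.
  exact: mul_unitarymx.
by apply: mul_unitarymx => //; apply: mul_unitarymx; rewrite ?trmxC_unitary.
Qed.

Lemma unitary_spectral n (u : 'M[C]_n) : u \is unitarymx ->
  exists P : 'M[C]_n, P \is unitarymx /\ exists d : 'rV_n,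
  u = P^t* *m diag_mx d *m P /\ forall i, `|d 0 i| = 1.
Proof.
move=> uu; have [P [Pu [d ud]]] := normal_spectral (unitary_normalmx uu).
exists P; split=> //; exists d; split=> //.
by apply/(conj_diag_unitaryP d Pu); rewrite -ud.
Qed.

Lemma conj_diagM n (P : 'M[C]_n) (d f : 'rV[C]_n) : P \is unitarymx ->
  (P^t* *m diag_mx d *m P) *m (P^t* *m diag_mx f *m P) =
  P^t* *m diag_mx (\row_j (d 0 j * f 0 j)) *m P.
Proof.
move=> Pu; rewrite !mulmxA -(mulmxA _ P) unitary_adjmxK// mulmx1.
by rewrite -(mulmxA _ (diag_mx d)) mulmx_diag.
Qed.

Lemma conj_diagZ n (P : 'M[C]_n) (c : C) (d : 'rV[C]_n) :
  c *: (P^t* *m diag_mx d *m P) = P^t* *m diag_mx (c *: d) *m P.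
Proof. by rewrite scalemxAl scalemxAr -linearZ. Qed.

Lemma conj_diag_adj n (P : 'M[C]_n) (d : 'rV[C]_n) :
  (P^t* *m diag_mx d *m P)^t* = P^t* *m diag_mx (map_mx Num.conj d) *m P.
Proof. by rewrite !adjmxM trmxCK adj_diag_mx mulmxA. Qed.

Lemma eq_conj_diag n (P : 'M[C]_n) (d f : 'rV[C]_n) :
  (forall j, d 0 j = f 0 j) -> P^t* *m diag_mx d *m P = P^t* *m diag_mx f *m P.
Proof. by move=> df; suff -> : d = f by []; apply/rowP. Qed.

Lemma conj_diagD n (P : 'M[C]_n) (d f : 'rV[C]_n) :
  P^t* *m diag_mx d *m P + P^t* *m diag_mx f *m P =
  P^t* *m diag_mx (d + f) *m P.
Proof. by rewrite -mulmxDl -mulmxDr -linearD. Qed.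

Lemma conj_diag0 n (P : 'M[C]_n) : P^t* *m diag_mx 0 *m P = 0.
Proof. by rewrite raddf0 mulmx0 mul0mx. Qed.

Lemma conj_diagX n (P : 'M[C]_n) (d : 'rV[C]_n) k : P \is unitarymx ->
  (P^t* *m diag_mx d *m P) ^+ k = P^t* *m diag_mx (\row_j (d 0 j ^+ k)) *m P.
Proof.
move=> Pu; elim: k => [|k IH].
  rewrite expr0 (_ : \row_j _ = const_mx 1); last first.
    by apply/rowP=> j; rewrite !mxE expr0.
  by rewrite diag_const_mx mulmx1 unitary_adjKmx.
rewrite exprS IH [LHS]conj_diagM//; apply: eq_conj_diag => j.
by rewrite !mxE exprS.
Qed.

(** Taking roots of the eigenvalues makes the root a function of u, so that it
    stays in the centre of any group having u in its centre. *)
Lemma unitary_root n (u : 'M[C]_n) k : u \is unitarymx -> (0 < k)%N ->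
  exists r : 'M[C]_n, [/\ r \is unitarymx, r ^+ k = u
    & forall B, comm_mx B u -> comm_mx B r].
Proof.
move=> uu k0; have [P [Pu [d [-> d1]]]] := unitary_spectral uu.
pose f := \row_j (k.-root (d 0 j)); exists (P^t* *m diag_mx f *m P); split.
- apply/(conj_diag_unitaryP f Pu) => i; rewrite mxE.
  have /(congr1 Num.norm) := rootCK k0 (d 0 i).
  rewrite normrX d1 => /eqP.
  by rewrite pexpr_eq1 ?normr_ge0// => /eqP.
- by rewrite conj_diagX//; apply: eq_conj_diag => j; rewrite !mxE rootCK.
- move=> B; apply: comm_spectral_fun => // i j.
  by rewrite !mxE => ->.
Qed.

(** Linear consequences for all of S follow from those for a finite list, to
    which simultaneous triangularisation applies. *)
Lemma finite_span n (S : set 'M[C]_n) : exists As : seq 'M[C]_n,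
  (forall A, A \in As -> S A) /\ (forall B, S B -> B \in <<As>>%VS).
Proof.
pose P d := `[< exists As : seq 'M[C]_n, (forall A, A \in As -> S A) /\
  \dim <<As>> = d >].
have exP : exists d, P d.
  by exists (\dim <<[::] : seq 'M[C]_n>>%VS); apply/asboolP; exists [::].
have ubP d : P d -> (d <= \dim {:'M[C]_n})%N.
  by move=> /asboolP[As [_ <-]]; exact/dimvS/subvf.
case: (ex_maxnP exP ubP) => d /asboolP[As [SAs <-]] maxd.
exists As; split=> // B SB; apply: contrapT => /negP BAs.
have /maxd : P (\dim <<B :: As>>).
  apply/asboolP; exists (B :: As); split=> // A; rewrite in_cons.
  by case/orP=> [/eqP->//|/SAs].
apply/negP; rewrite -ltnNge.
rewrite ltn_neqAle dimvS ?andbT; last first.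
  by rewrite span_cons; exact: addvSr.
apply: contra BAs => /eqP e.
have /eqP -> : <<As>>%VS == <<B :: As>>%VS.
  by rewrite eqEdim -e leqnn andbT span_cons addvSr.
by rewrite memv_span// mem_head.
Qed.

(** A unitary matrix triangularises all of S at once; as S is closed under
    adjoints, each member becomes triangular together with its adjoint, hence
    diagonal. *)
Lemma codiagonalization n (S : set 'M[C]_n) :
  (forall A, S A -> S (A^t*)) -> (forall A B, S A -> S B -> comm_mx A B) ->
  exists P : 'M[C]_n, P \is unitarymx /\
  forall A, S A -> exists d : 'rV_n, A = P^t* *m diag_mx d *m P.
Proof.
move=> Sadj Scomm; have [As [SAs spanAs]] := finite_span S.
have [|P Pu /allP trP] := @cotrigonalization C n As.
  by move=> A B /SAs SA /SAs SB; exact: Scomm.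
exists P; split=> //.
have tr A : S A -> is_trig_mx (P *m A *m P^t*).
  move=> /spanAs sA; rewrite (@coord_span _ _ _ (in_tuple As) A sA).
  rewrite mulmx_sumr mulmx_suml.
  apply/is_trig_mxP => i j ij; rewrite summxE big1// => k _.
  rewrite -scalemxAr -scalemxAl mxE.
  have /trP : (in_tuple As)`_k \in As by apply: mem_nth.
  rewrite /similar_to /= conjumx ?unitarymx_unit// invmx_unitary// => /is_trig_mxP -> //.
  by rewrite mulr0.
move=> A SA; have trA := tr _ SA; have := tr _ (Sadj _ SA).
have -> : P *m A^t* *m P^t* = (P *m A *m P^t*)^t*.
  by rewrite !adjmxM trmxCK mulmxA.
move=> /is_trig_mxP trA'.
have /diag_mxP[d Ad] : is_diag_mx (P *m A *m P^t*).
  apply/is_diag_mxP => i j; rewrite neq_ltn => /orP[ij|ji].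
    by move/is_trig_mxP: trA => ->.
  by have /eqP := trA' _ _ ji; rewrite mxE mxE conjC_eq0 => /eqP.
exists d; rewrite -Ad !mulmxA unitary_adjKmx// mul1mx.
by rewrite -mulmxA unitary_adjKmx// mulmx1.
Qed.

End UnitaryMatrices.


(** * Elements of maximal order *)

Section MaximalOrder.
Variables (K : fieldType) (I : Type).
Implicit Types (f g : I -> K) (e : nat).

Local Notation pw f e := (fun i => f i ^+ e).
Let one : I -> K := fun=> 1.

Definition has_order f a := (0 < a)%N /\ forall e, pw f e = one <-> (a %| e)%N.

Let pwM f e e' : pw (pw f e) e' = pw f (e * e').
Proof. by apply/funext => i; rewrite exprM. Qed.

Let pwE f e : pw f e = one -> forall i, f i ^+ e = 1.
Proof. by move=> fe i; have := congr1 (@^~ i) fe. Qed.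

Lemma has_order_ex f e : (0 < e)%N -> pw f e = one -> exists a, has_order f a.
Proof.
move=> e0 fe; pose p a := (0 < a)%N && `[< pw f a = one >].
have exp : exists a, p a by exists e; rewrite /p e0; apply/asboolP.
case: (ex_minnP exp) => a /andP[a0 /asboolP fa] mina.
exists a; split=> // d; split; last first.
  by move=> /dvdnP[q ->]; apply/funext=> i; rewrite mulnC exprM (pwE fa) expr1n.
move=> fd; rewrite /dvdn; case: posnP => // r0.
suff /mina : p (d %% a)%N by rewrite leqNgt ltn_mod a0.
rewrite /p r0; apply/asboolP/funext => i.
rewrite -[LHS]mul1r -(expr1n _ (d %/ a)) -(pwE fa i) -exprM mulnC -exprD.
by rewrite -divn_eq; exact: pwE.
Qed.

Lemma has_order_exp f a d : has_order f (a * d) -> has_order (pw f d) a.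
Proof.
move=> [ad fad]; have d0 : (0 < d)%N by move: ad; case: d {fad} => //; rewrite muln0.
split; first by move: ad; rewrite muln_gt0 => /andP[].
by move=> e; rewrite pwM fad mulnC dvdn_pmul2l.
Qed.

Lemma has_orderM f g a b : coprime a b -> has_order f a -> has_order g b ->
  has_order (fun i => f i * g i) (a * b).
Proof.
move=> ab [a0 fa] [b0 gb]; split=> [|e]; first by rewrite muln_gt0 a0.
split=> [fge|]; last first.
  move=> abe; have [/fa fe /gb ge] : (a %| e)%N /\ (b %| e)%N.
    by split; apply: dvdn_trans abe; [exact: dvdn_mulr|exact: dvdn_mull].
  apply/funext => i; rewrite exprMn (pwE fe) (pwE ge); exact: mulr1.
rewrite Gauss_dvd//; apply/andP; split.
  rewrite -(Gauss_dvdl e ab); apply/fa/funext => i.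
  have := pwE fge i => /(congr1 (fun z => z ^+ b)).
  rewrite expr1n !exprMn -!exprM.
  have -> : g i ^+ (e * b) = 1.
    by rewrite mulnC exprM (pwE ((gb b).2 (dvdnn b))) expr1n.
  by rewrite mulr1.
rewrite -(Gauss_dvdr e (_ : coprime b a)) 1?coprime_sym//; apply/gb/funext => i.
have := pwE fge i => /(congr1 (fun z => z ^+ a)).
rewrite expr1n !exprMn -!exprM.
have -> : f i ^+ (e * a) = 1.
  by rewrite mulnC exprM (pwE ((fa a).2 (dvdnn a))) expr1n.
by rewrite mul1r mulnC.
Qed.

(** In an abelian group of finite exponent some element has order equal to the
    exponent; here the group is one of functions under pointwise product.
    If f has the largest order a and some g has order b not dividing a, then
    v_p(a) < v_p(b) for some prime p, and trading the p-part of f for that of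
    g gives an element of larger order. *)
Lemma exponent_attained (A : set (I -> K)) N : (0 < N)%N -> A !=set0 ->
  (forall f g, A f -> A g -> A (fun i => f i * g i)) ->
  (forall f, A f -> pw f N = one) ->
  exists f a, [/\ A f, has_order f a & forall g, A g -> pw g a = one].
Proof.
move=> N0 [f0 Af0] AM AN.
have Apw f e : A f -> A (pw f e).
  move=> Af; elim: e => [|e IH].
    have -> : pw f 0 = pw f N by rewrite AN//; apply/funext=> i; rewrite expr0.
    case: N N0 AN => // N _ _; elim: N => [|N IH]; first exact: Af.
    rewrite (_ : pw f N.+2 = fun i => f i * pw f N.+1 i); first exact: AM.
    by apply/funext=> i; rewrite exprS.
  rewrite (_ : pw f e.+1 = fun i => f i * pw f e i); first exact: AM.
  by apply/funext=> i; rewrite exprS.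
pose P a := `[< exists2 f, A f & has_order f a >].
have exP : exists a, P a.
  have [a ha] := has_order_ex N0 (AN _ Af0).
  by exists a; apply/asboolP; exists f0.
have ubP a : P a -> (a <= N)%N.
  by move=> /asboolP[f Af [a0 fa]]; apply: dvdn_leq => //; apply/fa/AN.
case: (ex_maxnP exP ubP) => a /asboolP[f Af ha] maxa.
exists f, a; split=> // g Ag; have [b hb] := has_order_ex N0 (AN _ Ag).
apply/(hb.2); have [[a0 _] [b0 _]] := (ha, hb).
apply/(dvdn_partP a b0) => p pb.
have hf : has_order (pw f a`_p) a`_(negn p) by apply: has_order_exp; rewrite mulnC partnC.
have hg : has_order (pw g b`_(negn p)) b`_p by apply: has_order_exp; rewrite partnC.
have cop : coprime a`_(negn p) b`_p by rewrite coprime_sym coprime_partC.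
have /maxa : P (a`_(negn p) * b`_p)%N.
  apply/asboolP; exists (fun i => pw f a`_p i * pw g b`_(negn p) i).
    exact: AM (Apw _ _ Af) (Apw _ _ Ag).
  exact: has_orderM.
rewrite -{2}(partnC p a0) mulnC leq_pmul2r ?part_gt0// !p_part => le.
apply: dvdn_trans (dvdn_part p a); rewrite p_part dvdn_exp2l//.
have p1 : (1 < p)%N by move: pb; rewrite mem_primes => /and3P[/prime_gt1].
by rewrite -(leq_exp2l _ _ p1).
Qed.

End MaximalOrder.


(** * Block columns, clock and shift matrices *)

Section BlockMatrices.
Variables (C : numClosedFieldType) (n k p : nat).

Lemma sum_mxtens (V : nmodType) a b (F : 'I_(a * b) -> V) :
  \sum_i F i = \sum_j \sum_l F (mxtens_index (j, l)).
Proof.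
rewrite pair_big /= (reindex (@mxtens_index a b)) /=; last first.
  by exists (@mxtens_unindex a b) => i _; rewrite ?mxtens_indexK ?mxtens_unindexK.
by apply: eq_bigr => -[].
Qed.

(** The matrix [V_0 | ... | V_(k-1)], with columns indexed as in a tensor
    product. *)
Definition block_row (V : 'I_k -> 'M[C]_(n, p)) : 'M[C]_(n, k * p) :=
  \matrix_(i, j) V (mxtens_unindex j).1 i (mxtens_unindex j).2.

Lemma block_rowE V i j a : block_row V i (mxtens_index (j, a)) = V j i a.
Proof. by rewrite mxE mxtens_indexK. Qed.

Lemma mul_block_row (A : 'M[C]_n) V :
  A *m block_row V = block_row (fun j => A *m V j).
Proof.
apply/matrixP => i j; case: (mxtens_indexP j) => j0 a.
by rewrite block_rowE !mxE; apply: eq_bigr => l _; rewrite block_rowE.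
Qed.

Lemma block_row_tens1 V (A : 'M[C]_k) :
  block_row V *m (A *t (1%:M : 'M[C]_p)) =
  block_row (fun j => \sum_l A l j *: V l).
Proof.
apply/matrixP => i j; case: (mxtens_indexP j) => j0 a.
rewrite block_rowE mxE sum_mxtens summxE; apply: eq_bigr => l _.
rewrite (bigD1 a)//= big1 => [|b ba]; rewrite block_rowE tensmxE mxE.
  by rewrite eqxx mulr1 addr0 mulrC mxE.
by rewrite (negbTE ba) !mulr0.
Qed.

Lemma block_row_orthonormal V :
  (forall j l, (V j)^t* *m V l = (j == l)%:R%:M) ->
  (block_row V)^t* *m block_row V = 1%:M.
Proof.
move=> VV; apply/matrixP => i j.
case: (mxtens_indexP i) => i0 a; case: (mxtens_indexP j) => j0 b.
have /matrixP/(_ a b) := VV i0 j0; rewrite !mxE.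
rewrite (can_eq (@mxtens_indexK _ _)) xpair_eqE => VVab.
rewrite -mulnb natrM mulr_natr -VVab.
by apply: eq_bigr => l _; rewrite !mxE !mxtens_indexK.
Qed.

Lemma block_row_gram V :
  block_row V *m (block_row V)^t* = \sum_j V j *m (V j)^t*.
Proof.
apply/matrixP => i j; rewrite mxE sum_mxtens summxE; apply: eq_bigr => l _.
by rewrite mxE; apply: eq_bigr => a _; rewrite !mxE !mxtens_indexK.
Qed.

End BlockMatrices.

Section ClockShift.
Variable R : realType.
Local Notation C := (Cplx R).

Definition cis (x : R) : C := Complex (cos x) (sin x).

Lemma cisD x y : cis (x + y) = cis x * cis y.
Proof. by rewrite /cis cosD sinD; congr Complex; rewrite addrC mulrC. Qed.

Lemma cis0 : cis 0 = 1. Proof. by rewrite /cis cos0 sin0. Qed.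

Lemma norm_cis x : `|cis x| = 1.
Proof. by rewrite normc_def /= cos2Dsin2 sqrtr1. Qed.

Lemma cisX x e : cis x ^+ e = cis (e%:R * x).
Proof.
elim: e => [|e IH]; first by rewrite expr0 mul0r cis0.
by rewrite exprSr IH -cisD -natr1 mulrDl mul1r.
Qed.

Lemma omegaX k e : omega R k ^+ e = cis (e%:R * (2 * pi / k%:R)).
Proof. by rewrite -cisX. Qed.

Lemma omega_prim k : (0 < k)%N -> k.-primitive_root (omega R k).
Proof.
move=> k0; have kR : (k%:R : R) != 0 by rewrite pnatr_eq0 -lt0n.
have wk : omega R k ^+ k = 1.
  by rewrite omegaX mulrC divfK// mulr_natl /cis cos2pi sin2pi.
rewrite /primitive_root_of_unity k0 /=; apply/forallP => -[i ik] /=.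
apply/eqP; rewrite unity_rootE.
have [->|iSk] := eqVneq i.+1 k; first by rewrite wk eqxx.
apply/negbTE/negP => /eqP; rewrite omegaX => -[+ _].
have -> : i.+1%:R * (2 * pi / k%:R) = (i.+1%:R * pi / k%:R) *+ 2 :> R.
  by rewrite -mulr_natl; ring.
set t := _ / _; rewrite cos_mulr2n => /eqP; rewrite -subr_eq0.
rewrite cos2sin2 => h.
have : 0 < sin t.
  apply: sin_gt0_pi; apply/andP; split.
    by rewrite divr_gt0 ?mulr_gt0 ?pi_gt0 ?ltr0n.
  rewrite ltr_pdivrMr ?ltr0n// mulrC ltr_pM2l ?pi_gt0// ltr_nat.
  by rewrite ltn_neqAle iSk.
move/lt0r_neq0; suff -> : sin t = 0 by rewrite eqxx.
apply/eqP; rewrite -sqrf_eq0; apply/eqP.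
by move/eqP: h; lra.
Qed.

Lemma omega_expr1 k : omega R k ^+ k = 1.
Proof.
case: k => [|k]; first by rewrite expr0.
by apply: prim_expr_order; exact: omega_prim.
Qed.

Variable k : nat.
Local Notation w := (omega R k).
Local Notation Q := (clock_mx R k).
Local Notation P := (shift_mx R k).

Lemma clock_shift : P *m Q = w *: (Q *m P).
Proof.
apply/matrixP => i j.
rewrite /clock_mx mul_mx_diag mul_diag_mx !mxE.
case: eqP => [<-|_]; last by rewrite mulr0 mul0r mulr0.
by rewrite mulr1 mul1r /= -exprS (expr_mod i.+1 (omega_expr1 k)).
Qed.

Lemma clockX e : Q ^+ e = diag_mx (\row_(j < k) w ^+ (j * e)).
Proof.
elim: e => [|e IH].
  rewrite expr0 (_ : \row_j _ = const_mx 1) ?diag_const_mx//.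
  by apply/rowP => j; rewrite !mxE muln0 expr0.
rewrite exprS IH [LHS]mulmx_diag; congr diag_mx.
by apply/rowP => j; rewrite !mxE mulnS exprD.
Qed.

Lemma clock_expr1 : Q ^+ k = 1.
Proof.
rewrite clockX (_ : \row_j _ = const_mx 1) ?diag_const_mx//.
by apply/rowP => j; rewrite !mxE mulnC exprM omega_expr1 expr1n.
Qed.

Lemma shiftX e : P ^+ e = \matrix_(i, j) ((i + e) %% k == j)%N%:R.
Proof.
elim: e => [|e IH].
  by rewrite expr0; apply/matrixP=> i j; rewrite !mxE addn0 modn_small.
rewrite exprS IH; apply/matrixP => i j; rewrite mxE.
rewrite (bigD1 (ordS i))//= big1 ?addr0 => [|l /negbTE li]; rewrite !mxE.
  by rewrite eqxx mul1r /= modnDml addSnnS.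
by rewrite eq_sym li mul0r.
Qed.

Lemma shift_expr1 : P ^+ k = 1.
Proof.
rewrite shiftX; apply/matrixP => i j; rewrite !mxE modnDr modn_small//.
Qed.

(** Commuting with the clock makes X block diagonal, commuting with the shift
    makes the blocks equal. *)
Lemma clock_shift_commutant p (X : 'M[C]_(k * p)) : (0 < k)%N ->
  comm_mx X (Q *t (1%:M : 'M[C]_p)) -> comm_mx X (P *t (1%:M : 'M[C]_p)) ->
  exists t : 'M[C]_p, X = (1%:M : 'M[C]_k) *t t.
Proof.
move=> k0 /matrixP XQ /matrixP XP.
have mulr (A : 'M[C]_k) i a j b :
    (X *m (A *t (1%:M : 'M[C]_p))) (mxtens_index (i, a)) (mxtens_index (j, b)) =
    \sum_l X (mxtens_index (i, a)) (mxtens_index (l, b)) * A l j.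
  rewrite mxE sum_mxtens; apply: eq_bigr => l _.
  rewrite (bigD1 b)//= big1 => [|c cb]; rewrite tensmxE mxE.
    by rewrite eqxx mulr1 addr0.
  by rewrite (negbTE cb) !mulr0.
have mull (A : 'M[C]_k) i a j b :
    ((A *t (1%:M : 'M[C]_p)) *m X) (mxtens_index (i, a)) (mxtens_index (j, b)) =
    \sum_l A i l * X (mxtens_index (l, a)) (mxtens_index (j, b)).
  rewrite mxE sum_mxtens; apply: eq_bigr => l _.
  rewrite (bigD1 a)//= big1 => [|c ca]; rewrite tensmxE mxE.
    by rewrite eqxx mulr1 addr0.
  by rewrite eq_sym (negbTE ca) !(mulr0, mul0r).
have diagX i a j b : i != j ->
    X (mxtens_index (i, a)) (mxtens_index (j, b)) = 0.
  move=> ij; have := XQ (mxtens_index (i, a)) (mxtens_index (j, b)).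
  rewrite mulr mull (bigD1 j)//= big1 => [|l lj]; last first.
    by rewrite !mxE (negbTE lj) mulr0.
  rewrite (bigD1 i)//= big1 => [|l li]; last first.
    by rewrite !mxE eq_sym (negbTE li) mul0r.
  rewrite !mxE !eqxx !addr0 mulrC => /eqP.
  rewrite -subr_eq0 -mulrBl mulf_eq0 => /orP[|/eqP//].
  rewrite subr_eq0 (eq_prim_root_expr (omega_prim k0)) !modn_small//.
  by rewrite val_eqE eq_sym (negbTE ij).
have shX i a b : X (mxtens_index (i, a)) (mxtens_index (i, b)) =
    X (mxtens_index (ordS i, a)) (mxtens_index (ordS i, b)).
  have := XP (mxtens_index (i, a)) (mxtens_index (ordS i, b)).
  rewrite mulr mull (bigD1 i)//= big1 => [|l li]; last first.
    by rewrite diagX ?mul0r// eq_sym.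
  rewrite (bigD1 (ordS i))//= big1 => [|l li]; last first.
    by rewrite diagX ?mulr0// eq_sym.
  by rewrite !mxE !eqxx mul1r mulr1 !addr0.
pose o := Ordinal k0.
have cstX i a b : X (mxtens_index (i, a)) (mxtens_index (i, b)) =
    X (mxtens_index (o, a)) (mxtens_index (o, b)).
  case: i => i; elim: i => [|i IH] ik; first by rewrite (_ : Ordinal ik = o)//; exact: val_inj.
  have ik' : (i < k)%N by exact: ltnW.
  rewrite -(IH ik') [RHS]shX; suff -> : ordS (Ordinal ik') = Ordinal ik by [].
  by apply: val_inj; rewrite /= modn_small.
exists (\matrix_(a, b) X (mxtens_index (o, a)) (mxtens_index (o, b))).
apply/matrixP => u v; case: (mxtens_indexP u) => i a.
case: (mxtens_indexP v) => j b; rewrite tensmxE !mxE.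
have [<-|ij] := eqVneq i j; first by rewrite mul1r cstX.
by rewrite mul0r diagX.
Qed.

(** The preimage of [Hgroup] in the unitary group ([lifts_Hgroup]). *)
Definition Hmat : set 'M[C]_k :=
  [set A | exists l : C, `|l| = 1 /\ exists a b, A = l *: (Q ^+ a *m P ^+ b)].

End ClockShift.
Arguments Hmat : clear implicits.

(** * Groups of Heisenberg type *)

Section HeisenbergSets.
Variable C : numClosedFieldType.

(** A group of Heisenberg type: the commutators are scalars.  Its image in the
    projective unitary group is abelian, and [heisZ] is what the equality of
    dimensions amounts to for that image.  The exponent K is recorded because
    it bounds the sizes of the clock and shift pairs found in S. *)
Record heis n (S : set 'M[C]_n) (K : nat) : Prop := Heis {
  heisU : forall A, S A -> A \is unitarymx;
  heisM : forall A B, S A -> S B -> S (A *m B);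
  heisV : forall A, S A -> S (A^t*);
  heisC : forall A B, S A -> S B ->
    exists c : C, A *m B = c *: (B *m A) /\ c ^+ K = 1;
  heisZ : forall u, u \is unitarymx -> (forall A, S A -> comm_mx u A) -> S u }.

Lemma heis_scale n (S : set 'M[C]_n) K (l : C) A :
  heis S K -> `|l| = 1 -> S A -> S (l *: A).
Proof.
move=> hS l1 SA; rewrite -[A]mul1mx scalemxAl; apply: (heisM hS) => //.
apply: (heisZ hS) => [|B _]; last by rewrite scalemx1 /comm_mx scalar_mxC.
by apply: scale_unitarymx => //; apply/unitarymxP; rewrite trmx1 map_mx1 mulmx1.
Qed.

Lemma heis1 n (S : set 'M[C]_n) K : heis S K -> S 1%:M.
Proof.
move=> hS; apply: (heisZ hS) => [|B _]; last by rewrite /comm_mx scalar_mxC.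
by apply/unitarymxP; rewrite trmx1 map_mx1 mulmx1.
Qed.

Lemma heisX n (S : set 'M[C]_n) K A e : heis S K -> S A -> S (A ^+ e).
Proof.
move=> hS SA; elim: e => [|e IH]; first exact: (heis1 hS).
by rewrite exprS; exact: (heisM hS).
Qed.

(** Base case of the classification: diagonalise S; any other unitary matrix
    diagonal in the same basis centralises S, so it lies in S by [heisZ]. *)
Lemma comm_heis_diag n (S : set 'M[C]_n) K : heis S K ->
  (forall A B, S A -> S B -> comm_mx A B) ->
  exists P : 'M[C]_n, P \is unitarymx /\
  S = [set P^t* *m diag_mx d *m P | d in [set d : 'rV[C]_n | forall i, `|d 0 i| = 1]].
Proof.
move=> hS cS; have [P [Pu PS]] := codiagonalization (heisV hS) cS.
exists P; split=> //; apply/seteqP; split=> [A SA|_ [d d1 <-]].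
  have [d Ad] := PS A SA; exists d => //=.
  by apply/(conj_diag_unitaryP d Pu); rewrite -Ad; exact: (heisU hS).
apply: (heisZ hS) => [|A SA]; first exact/conj_diag_unitaryP.
have [f ->] := PS A SA.
rewrite /comm_mx !conj_diagM//; congr (_ *m diag_mx _ *m _).
by apply/rowP=> j; rewrite !mxE mulrC.
Qed.

(** When A B = c B A with A and B unitary, this trace is c; a closed formula
    makes the scalar a function of A and B. *)
Definition mxcomm n (A B : 'M[C]_n) : C :=
  \tr (A *m B *m A^t* *m B^t*) / n%:R.

Lemma mxcommE n (A B : 'M[C]_n) c : (0 < n)%N ->
  A \is unitarymx -> B \is unitarymx ->
  A *m B = c *: (B *m A) -> mxcomm A B = c.
Proof.
move=> n0 Au Bu AB; rewrite /mxcomm AB -!scalemxAl -(mulmxA B) unitary_adjmxK//.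
rewrite mulmx1 unitary_adjmxK// scalemx1 mxtrace_scalar -[c *+ _]mulr_natr mulfK//.
by rewrite pnatr_eq0 -lt0n.
Qed.

Section Commutators.
Variables (n : nat) (S : set 'M[C]_n) (K : nat).
Hypotheses (n0 : (0 < n)%N) (hS : heis S K).

Lemma mxcommP A B : S A -> S B -> A *m B = mxcomm A B *: (B *m A).
Proof.
move=> SA SB; have [c [AB _]] := heisC hS SA SB.
by rewrite (mxcommE n0 _ _ AB) ?(heisU hS).
Qed.

Lemma mxcomm_exp A B : S A -> S B -> mxcomm A B ^+ K = 1.
Proof.
move=> SA SB; have [c [AB cK]] := heisC hS SA SB.
by rewrite (mxcommE n0 _ _ AB) ?(heisU hS).
Qed.

Lemma mxcommMl A A' B : S A -> S A' -> S B ->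
  mxcomm (A *m A') B = mxcomm A B * mxcomm A' B.
Proof.
move=> SA SA' SB; apply: mxcommE => //; try exact: (heisU hS).
  by apply: (heisU hS); exact: (heisM hS).
rewrite -(mulmxA A A' B) (mxcommP SA' SB) -scalemxAr (mulmxA A B A').
by rewrite (mxcommP SA SB) -scalemxAl scalerA -mulmxA mulrC.
Qed.

Lemma mxcommMr A B B' : S A -> S B -> S B' ->
  mxcomm A (B *m B') = mxcomm A B * mxcomm A B'.
Proof.
move=> SA SB SB'; apply: mxcommE => //; try exact: (heisU hS).
  by apply: (heisU hS); exact: (heisM hS).
rewrite (mulmxA A B B') (mxcommP SA SB) -scalemxAl -(mulmxA B A B').
by rewrite (mxcommP SA SB') -scalemxAr scalerA mulmxA.
Qed.

Lemma mxcommXl A B e : S A -> S B -> mxcomm (A ^+ e) B = mxcomm A B ^+ e.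
Proof.
move=> SA SB; elim: e => [|e IH].
  apply: mxcommE => //; try exact: (heisU hS).
    exact: (heisU hS (heis1 hS)).
  by rewrite !expr0 scale1r mul1mx mulmx1.
by rewrite exprS [LHS]mxcommMl// ?IH ?exprS//; exact: (heisX _ hS).
Qed.

Lemma mxcommC A B : S A -> S B -> mxcomm B A = (mxcomm A B)^-1.
Proof.
move=> SA SB; apply: mxcommE => //; try exact: (heisU hS).
rewrite (mxcommP SA SB) scalerA mulVf ?scale1r//.
apply/eqP => c0; have := mxcommP SA SB; rewrite c0 scale0r => AB0.
have := heisU hS (heisM hS SA SB); rewrite AB0 => /mxrank_unitary.
by rewrite mxrank0 => n00; move: n0; rewrite -n00.
Qed.

(** Apply [exponent_attained] twice: to the functions mxcomm x _, which gives
    an x of largest order k modulo the centre, and then to the values of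
    mxcomm x _, whose exponent is k again. *)
Lemma primitive_commutator : (0 < K)%N -> exists k x y,
  [/\ S x, S y, k.-primitive_root (mxcomm x y)
    & forall A B, S A -> S B -> mxcomm A B ^+ k = 1].
Proof.
move=> K0.
pose I := {B | S B}.
pose A1 : set (I -> C) := [set f | exists2 x, S x & f = fun B : I => mxcomm x (sval B)].
have [|f g [x Sx ->] [y Sy ->]|f [x Sx ->]|f [k [[x Sx ->] hk kall]]] :=
  @exponent_attained C I A1 K K0.
- by exists (fun B : I => mxcomm 1%:M (sval B)), 1%:M => //; exact: (heis1 hS).
- exists (x *m y); first exact: (heisM hS).
  by apply/funext => -[B SB] /=; rewrite mxcommMl.
- by apply/funext => -[B SB] /=; rewrite mxcomm_exp.
have allk A B : S A -> S B -> mxcomm A B ^+ k = 1.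
  move=> SA SB; have Af : A1 (fun B : I => mxcomm A (sval B)) by exists A.
  by have := congr1 (@^~ (exist _ B SB)) (kall _ Af).
have k0 : (0 < k)%N by case: hk.
pose A2 : set (unit -> C) := [set f | exists2 y, S y & f = fun=> mxcomm x y].
have [|f1 g [z Sz ->] [y Sy ->]|f1 [y Sy ->]|f1 [b [[y Sy ->] hb ball]]] :=
  @exponent_attained C unit A2 k k0.
- by exists (fun=> mxcomm x x), x.
- exists (z *m y); first exact: (heisM hS).
  by apply/funext => -[] /=; rewrite mxcommMr.
- by apply/funext => -[]; rewrite /= allk.
exists k, x, y; split=> //.
have bk : (b = k)%N.
  apply/eqP; rewrite eqn_dvd; apply/andP; split.
    by apply/(hb.2)/funext => -[] /=; exact: allk.
  apply/(hk.2)/funext => -[B SB] /=.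
  have Bf : A2 (fun=> mxcomm x B) by exists B.
  by have := congr1 (@^~ tt) (ball _ Bf).
rewrite -bk in hb *.
have /prim_order_exists[//|m pm] := congr1 (@^~ tt) ((hb.2 b).2 (dvdnn b)).
  by case: hb.
move=> mb; suff /eqP <- : m == b by [].
rewrite eqn_dvd mb; apply/(hb.2)/funext => -[] /=; exact: prim_expr_order.
Qed.

End Commutators.

End HeisenbergSets.

(** * Normal form of a clock and shift pair *)

Section SymplecticPair.
Variable C : numClosedFieldType.

(** The power x^k is central, and the centre is divisible: multiplying x by a
    central k-th root of the inverse of x^k makes its order divide k. *)
Lemma split_order n (S : set 'M[C]_n) K k x : (0 < n)%N -> heis S K ->
  (0 < k)%N -> S x -> (forall B, S B -> mxcomm x B ^+ k = 1) ->
  exists z, [/\ S z, z ^+ k = 1 & forall B, S B -> mxcomm z B = mxcomm x B].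
Proof.
move=> n0 hS k0 Sx xk.
have mxcomm1 B : S B -> mxcomm 1%:M B = 1.
  by move=> SB; have := mxcommXl n0 hS 0 Sx SB; rewrite !expr0.
have Sxk := heisX k hS Sx; pose u := (x ^+ k)^t*.
have Su : S u by exact: (heisV hS).
have uxk : x ^+ k *m u = 1%:M by apply: unitary_adjmxK; exact: (heisU hS).
have uB B : S B -> comm_mx B u.
  move=> SB; rewrite /comm_mx (mxcommP n0 hS Su SB) (_ : mxcomm u B = 1) ?scale1r//.
  have := mxcommMl n0 hS Sxk Su SB.
  by rewrite uxk mxcomm1// (mxcommXl n0 hS)// xk// mul1r.
have [r [ru rk rB]] := unitary_root (heisU hS Su) k0.
have rS B : S B -> comm_mx r B by move=> /uB/rB/esym.
have Sr : S r by exact: (heisZ hS).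
exists (x *m r); split; first exact: (heisM hS).
  by rewrite exprMn_comm ?rk//; apply/esym/rS.
move=> B SB; rewrite (mxcommMl n0 hS)// (_ : mxcomm r B = 1) ?mulr1//.
by apply: mxcommE => //; [exact: (heisU hS)|rewrite scale1r; exact: rS].
Qed.

(** The columns of B are an orthonormal basis of the range of E. *)
Lemma proj_isometry n (E : 'M[C]_n) : E^t* = E -> E *m E = E ->
  exists p (B : 'M[C]_(n, p)), B^t* *m B = 1%:M /\ B *m B^t* = E.
Proof.
move=> Eh EE.
have [r [Q [Qu QE]]] : exists r (Q : 'M[C]_(r, n)), Q *m Q^t* = 1%:M /\ (Q :=: E)%MS.
  exists (\rank E), (schmidt (row_base E)); split.
    by apply/unitarymxP/schmidt_unitarymx/rank_leq_col.
  by apply: eqmx_trans (eq_row_base E); apply/eqmx_schmidt_free/row_base_free.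
exists r, (Q^t*); rewrite trmxCK; split=> //.
have QEQ : Q *m E = Q.
  have /submxP[Z ->] : (Q <= E)%MS by rewrite QE.
  by rewrite -mulmxA EE.
have EQQ : E *m (Q^t* *m Q) = E.
  have /submxP[W ->] : (E <= Q)%MS by rewrite QE.
  by rewrite -mulmxA (mulmxA Q) Qu mul1mx.
have -> : Q^t* *m Q = (E *m (Q^t* *m Q)).
  by rewrite mulmxA -[in E *m _]Eh -adjmxM QEQ.
exact: EQQ.
Qed.

Lemma isometry_square a b (G : 'M[C]_(a, b)) :
  G *m G^t* = 1%:M -> G^t* *m G = 1%:M -> a = b.
Proof.
move=> GG GG'; apply/eqP; rewrite eqn_leq.
have := mxrankM_maxr G (G^t*); have := mxrankM_maxr (G^t*) G.
rewrite GG GG' !mxrank1 => ba ab; apply/andP; split.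
  exact: leq_trans ab (rank_leq_row _).
exact: leq_trans ba (rank_leq_row _).
Qed.

Lemma geometric_sum0 k (z : C) : z ^+ k = 1 -> z != 1 -> \sum_(i < k) z ^+ i = 0.
Proof.
move=> zk z1; apply/eqP; have /eqP := subrX1 z k.
by rewrite zk subrr eq_sym mulf_eq0 subr_eq0 (negbTE z1).
Qed.

End SymplecticPair.

Section ClockShiftRepresentation.
Variable R : realType.
Local Notation C := (Cplx R).
Variables (n k : nat) (x y : 'M[C]_n).
Local Notation w := (omega R k).
Hypotheses (k0 : (0 < k)%N) (xu : x \is unitarymx) (yu : y \is unitarymx).
Hypotheses (xk : x ^+ k = 1) (yk : y ^+ k = 1) (yx : y *m x = w *: (x *m y)).

Let v := y^t*.
Let yv : y *m v = 1%:M. Proof. exact: unitary_adjmxK. Qed.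
Let vy : v *m y = 1%:M. Proof. exact: unitary_adjKmx. Qed.

Let w0 : w != 0.
Proof. by rewrite -normr_eq0 omega_norm oner_eq0. Qed.

Let vX_yX j : v ^+ j *m y ^+ j = 1%:M.
Proof.
elim: j => [|j IH]; first by rewrite !expr0 mulmx1.
by rewrite mxpowSr mxpowS -mulmxA (mulmxA v y) vy mul1mx.
Qed.

Let xv : x *m v = w *: (v *m x).
Proof.
have := congr1 (fun X => v *m X *m v) yx.
rewrite -scalemxAr -scalemxAl !mulmxA vy mul1mx => ->.
by rewrite -(mulmxA _ y v) yv mulmx1.
Qed.

Let xvX j : x *m v ^+ j = w ^+ j *: (v ^+ j *m x).
Proof.
elim: j => [|j IH]; first by rewrite !expr0 scale1r mulmx1 mul1mx.
rewrite mxpowSr mulmxA IH -scalemxAl -mulmxA xv.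
by rewrite -scalemxAr scalerA -exprSr mulmxA.
Qed.

Let xXvX l j : x ^+ l *m v ^+ j = w ^+ (l * j) *: (v ^+ j *m x ^+ l).
Proof.
elim: l => [|l IH]; first by rewrite mul0n !expr0 scale1r mulmx1 mul1mx.
rewrite mxpowS -mulmxA IH -scalemxAr (mulmxA x).
by rewrite xvX -scalemxAl scalerA mulSn addnC exprD -mulmxA.
Qed.

Let conj_clock l j : v ^+ j *m x ^+ l *m y ^+ j = w^-1 ^+ (l * j) *: x ^+ l.
Proof.
have := congr1 (fun X => w^-1 ^+ (l * j) *: (X *m y ^+ j)) (xXvX l j).
rewrite -scalemxAl scalerA exprVn mulVf ?expf_neq0// scale1r => <-.
by rewrite -mulmxA vX_yX mulmx1.
Qed.

(** The orthogonal projection onto the fixed space of x. *)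
Let E := k%:R^-1 *: \sum_(l < k) x ^+ l.

Let xE : x *m E = E.
Proof.
rewrite /E -scalemxAr mulmx_sumr; congr (_ *: _).
case: k k0 xk => // m _ xm.
rewrite big_ord_recr [RHS]big_ord_recl /= addrC; congr (_ + _).
  by rewrite -mxpowS xm expr0.
by apply: eq_bigr => i _; rewrite -mxpowS.
Qed.

Let kC : (k%:R : C) != 0. Proof. by rewrite pnatr_eq0 -lt0n. Qed.

Let xXE l : x ^+ l *m E = E.
Proof.
elim: l => [|l IH]; first by rewrite expr0 mul1mx.
by rewrite mxpowSr -mulmxA xE.
Qed.

Let EE : E *m E = E.
Proof.
rewrite {1}/E -scalemxAl mulmx_suml (eq_bigr (fun=> E)) => [|l _]; last exact: xXE.
by rewrite sumr_const card_ord -[E *+ _]scaler_nat scalerA mulVf// scale1r.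
Qed.

(* The adjoint of x fixes E because x does, so E^* E = E. *)
Let Eadj : E^t* = E.
Proof.
have xaE : x^t* *m E = E by rewrite -{1}xE mulmxA unitary_adjKmx// mul1mx.
have xaXE l : (x ^+ l)^t* *m E = E.
  rewrite adjmxX; elim: l => [|l IH]; first by rewrite expr0 mul1mx.
  by rewrite mxpowSr -mulmxA xaE.
have adjEE : E^t* *m E = E.
  rewrite {1}/E adjmxZ -scalemxAl raddf_sum /= raddf_sum mulmx_suml.
  rewrite (eq_bigr (fun=> E)) => [|l _]; last exact: xaXE.
  rewrite sumr_const card_ord -[E *+ _]scaler_nat scalerA fmorphV rmorph_nat.
  by rewrite mulVf// scale1r.
by rewrite -{1}adjEE adjmxM trmxCK adjEE.
Qed.

(** A pair obeying the clock and shift relations is a multiple of the standard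
    pair: if the columns of B form an orthonormal basis of the fixed space of
    x, then [B | y^-1 B | y^-2 B | ...] is the intertwining unitary matrix. *)
Lemma clock_shift_rep : exists p (G : 'M[C]_(n, k * p)),
  [/\ G *m G^t* = 1%:M, G^t* *m G = 1%:M,
      G *m (clock_mx R k *t (1%:M : 'M[C]_p)) = x *m G &
      G *m (shift_mx R k *t (1%:M : 'M[C]_p)) = y *m G].
Proof.
have [p [B [BB BE]]] := proj_isometry Eadj EE.
have EB : E *m B = B by rewrite -BE -mulmxA BB mulmx1.
have xB : x *m B = B by rewrite -EB mulmxA xE.
pose V (j : 'I_k) := v ^+ j *m B.
have xV j : x *m V j = w ^+ j *: V j.
  by rewrite /V mulmxA xvX -scalemxAl -mulmxA xB.
have adjv j : (v ^+ j)^t* = y ^+ j by rewrite adjmxX /v trmxCK.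
have yXvX j : y ^+ j *m v ^+ j = 1%:M by apply: mulmx1C.
exists p, (block_row V); split.
- (* The conjugates of E by the powers of y project onto the eigenspaces of
     x, and they add up to 1. *)
  rewrite block_row_gram.
  have VV j : V j *m (V j)^t* = v ^+ j *m E *m y ^+ j.
    by rewrite /V adjmxM adjv -BE !mulmxA.
  under eq_bigr do rewrite VV.
  rewrite /E.
  under eq_bigr do rewrite -scalemxAr -scalemxAl mulmx_sumr mulmx_suml.
  rewrite -scaler_sumr exchange_big /=.
  under eq_bigr => l _ do under eq_bigr do rewrite conj_clock exprM.
  under eq_bigr => l _ do rewrite -scaler_suml.
  rewrite (bigD1 (Ordinal k0))//= [X in _ + X]big1 => [|l l0].
    rewrite (eq_bigr (fun=> 1)) => [|j _]; last by rewrite /= expr0 expr1n.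
    by rewrite sumr_const card_ord addr0 expr0 scalerA mulVf// scale1r.
  rewrite geometric_sum0 ?scale0r//.
    by rewrite -exprM mulnC exprM exprVn omega_expr1 invr1 expr1n.
  rewrite exprVn invr_eq1 -(expr0 w) (eq_prim_root_expr (omega_prim R k0)).
  by rewrite !modn_small.
- apply: block_row_orthonormal => j l; have [<-|jl] := eqVneq j l.
    by rewrite /V adjmxM adjv -mulmxA (mulmxA (y ^+ j)) yXvX mul1mx BB.
  (* Eigenspaces of x for different eigenvalues are orthogonal. *)
  rewrite mulr0n raddf0; apply/eqP.
  have : (V j)^t* *m V l = ((w ^+ j)^* * w ^+ l) *: ((V j)^t* *m V l).
    rewrite -scalerA scalemxAr -xV scalemxAl -adjmxZ -xV adjmxM -mulmxA.
    by rewrite (mulmxA (x^t*)) unitary_adjKmx// mul1mx.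
  move/eqP; rewrite -subr_eq0 -[X in X - _]scale1r -scalerBl scaler_eq0.
  case/orP=> //; rewrite subr_eq0 => /eqP wjl; case/negP: jl.
  have : w ^+ j = w ^+ l.
    by rewrite -[LHS]mulr1 wjl mulrA -normCK normrX omega_norm !expr1n mul1r.
  move/eqP; rewrite (eq_prim_root_expr (omega_prim R k0)) !modn_small//.
- rewrite block_row_tens1 mul_block_row; congr block_row; apply/funext => j.
  rewrite xV (bigD1 j)//= big1 => [|l lj]; rewrite !mxE.
    by rewrite eqxx addr0.
  by rewrite (negbTE lj) scale0r.
- rewrite block_row_tens1 mul_block_row; congr block_row; apply/funext => j.
  rewrite (bigD1 (ord_pred j))//= big1 => [|l lj].
    rewrite !mxE ord_predK eqxx scale1r addr0.
    rewrite -[in RHS](ord_predK j).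
    move: (ord_pred j) => l; rewrite /V /= expr_mod; last first.
      by have := vX_yX k; rewrite yk mulmx1.
    by rewrite mxpowS !mulmxA yv mul1mx.
  rewrite !mxE; case: eqP => [ljE|_]; last by rewrite scale0r.
  by rewrite -ljE ordSK eqxx in lj.
Qed.

End ClockShiftRepresentation.

(** * Splitting off a tensor factor *)

Section ConjugateHeisenbergSets.
Variable C : numClosedFieldType.

Definition isometric a b (G : 'M[C]_(a, b)) : Prop :=
  G *m G^t* = 1%:M /\ G^t* *m G = 1%:M.

Lemma isometric_adj a b (G : 'M[C]_(a, b)) : isometric G -> isometric (G^t*).
Proof. by move=> [GG GG']; split; rewrite trmxCK. Qed.

Lemma isometricM a b c (G : 'M[C]_(a, b)) (H : 'M[C]_(b, c)) :
  isometric G -> isometric H -> isometric (G *m H).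
Proof.
move=> [GG GG'] [HH HH']; split; rewrite adjmxM.
  by rewrite mulmxA -(mulmxA G) HH mulmx1.
by rewrite mulmxA -(mulmxA (H^t*)) GG' mulmx1.
Qed.

Lemma isometric_unitary a (G : 'M[C]_a) : isometric G <-> G \is unitarymx.
Proof.
split=> [[GG _]|Gu]; first exact/unitarymxP.
by split; [exact: unitary_adjmxK | exact: unitary_adjKmx].
Qed.

Definition transport a b (G : 'M[C]_(a, b)) (S : set 'M[C]_b) : set 'M[C]_a :=
  [set G *m A *m G^t* | A in S].

Lemma transportM a b c (G : 'M[C]_(a, b)) (H : 'M[C]_(b, c)) S :
  transport (G *m H) S = transport G (transport H S).
Proof.
apply/seteqP; split=> [_ [A SA <-]|_ [_ [A SA <-] <-]].
  by exists (H *m A *m H^t*); [exists A|rewrite adjmxM !mulmxA].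
by exists A; rewrite // adjmxM !mulmxA.
Qed.

Lemma transportK a b (G : 'M[C]_(a, b)) S : G *m G^t* = 1%:M ->
  transport G (transport (G^t*) S) = S.
Proof.
move=> GG; apply/seteqP; split=> [_ [_ [A SA <-] <-]|A SA].
  by rewrite trmxCK -!mulmxA GG mulmx1 !mulmxA GG mul1mx.
exists (G^t* *m A *m G); first by exists A; rewrite // trmxCK.
by rewrite -!mulmxA GG mulmx1 !mulmxA GG mul1mx.
Qed.

Lemma transport_mul a b (G : 'M[C]_(a, b)) (A B : 'M[C]_b) :
  isometric G -> (G *m A *m G^t*) *m (G *m B *m G^t*) = G *m (A *m B) *m G^t*.
Proof. by move=> [_ GG]; rewrite !mulmxA -(mulmxA _ (G^t*) G) GG mulmx1. Qed.

Lemma heis_transport a b (G : 'M[C]_(a, b)) S K : isometric G ->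
  heis S K -> heis (transport G S) K.
Proof.
move=> Gi hS; have [GG GG'] := Gi.
have adjG A : (G *m A *m G^t*)^t* = G *m A^t* *m G^t*.
  by rewrite !adjmxM trmxCK mulmxA.
split.
- move=> _ [A SA <-]; apply/unitarymxP; rewrite adjG transport_mul//.
  by rewrite unitary_adjmxK ?(heisU hS)// mulmx1.
- move=> _ _ [A SA <-] [B SB <-]; rewrite transport_mul//.
  by exists (A *m B) => //; exact: (heisM hS).
- move=> _ [A SA <-]; rewrite adjG; exists (A^t*) => //; exact: (heisV hS).
- move=> _ _ [A SA <-] [B SB <-]; have [c [AB cK]] := heisC hS SA SB.
  exists c; split=> //; rewrite !transport_mul// AB.
  by rewrite -scalemxAr -scalemxAl.
- move=> u uu uS; exists (G^t* *m u *m G); last first.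
    by rewrite -!mulmxA GG mulmx1 !mulmxA GG mul1mx.
  apply: (heisZ hS) => [|A SA].
    apply/unitarymxP; rewrite !adjmxM trmxCK !mulmxA -(mulmxA _ G) GG mulmx1.
    by rewrite -(mulmxA _ u) unitary_adjmxK// mulmx1.
  have /(congr1 (fun X => G^t* *m X *m G)) : comm_mx u (G *m A *m G^t*).
    by apply: uS; exists A.
  by rewrite /comm_mx !mulmxA GG' mul1mx -!mulmxA GG' mulmx1.
Qed.

End ConjugateHeisenbergSets.

Section TensorFactor.
Variable R : realType.
Local Notation C := (Cplx R).

Lemma adj_tens a b c d (A : 'M[C]_(a, b)) (B : 'M[C]_(c, d)) :
  (A *t B)^t* = A^t* *t B^t*.
Proof. by rewrite trmx_tens map_mxT. Qed.

Lemma tens11 a b : (1%:M : 'M[C]_a) *t (1%:M : 'M[C]_b) = 1%:M.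
Proof.
apply/matrixP => i j; case: (mxtens_indexP i) => i1 i2.
case: (mxtens_indexP j) => j1 j2.
by rewrite tensmxE !mxE (can_eq (@mxtens_indexK _ _)) -natrM mulnb.
Qed.

Lemma tensZl a b (c : C) (A : 'M[C]_a) (B : 'M[C]_b) : (c *: A) *t B = c *: (A *t B).
Proof. by apply/matrixP => i j; rewrite !mxE mulrA. Qed.

Lemma tensZr a b (c : C) (A : 'M[C]_a) (B : 'M[C]_b) : A *t (c *: B) = c *: (A *t B).
Proof. by apply/matrixP => i j; rewrite !mxE mulrCA. Qed.

Lemma tens1_inj a b (B B' : 'M[C]_b) : (0 < a)%N ->
  (1%:M : 'M[C]_a) *t B = (1%:M : 'M[C]_a) *t B' -> B = B'.
Proof.
move=> a0 /matrixP h; apply/matrixP => i j; pose o := Ordinal a0.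
have := h (mxtens_index (o, i)) (mxtens_index (o, j)).
by rewrite !tensmxE !mxE eqxx !mul1r.
Qed.

Lemma tensX a b (A : 'M[C]_a) e :
  (A *t (1%:M : 'M[C]_b)) ^+ e = A ^+ e *t (1%:M : 'M[C]_b).
Proof.
elim: e => [|e IH]; first by rewrite !expr0 tens11.
by rewrite !mxpowS IH tensmx_mul mulmx1.
Qed.

(** The factor complementary to a standard clock and shift pair.  An element of
    S can be multiplied by powers of the pair so as to commute with the pair,
    and what commutes with the pair has the form 1 (x) t. *)
Lemma heis_tensor k p (S : set 'M[C]_(k * p)) : (0 < k)%N -> (0 < p)%N ->
  heis S k -> S (clock_mx R k *t (1%:M : 'M[C]_p)) ->
  S (shift_mx R k *t (1%:M : 'M[C]_p)) ->
  exists T : set 'M[C]_p, heis T k /\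
    S = [set A | exists h t, [/\ Hmat R k h, T t & A = h *t t]].
Proof.
move=> k0 p0 hS; set X := clock_mx R k *t _; set Y := shift_mx R k *t _ => SX SY.
have kp0 : (0 < k * p)%N by rewrite muln_gt0 k0.
have wP := omega_prim R k0.
pose T := [set t : 'M[C]_p | S ((1%:M : 'M[C]_k) *t t)].
have Tu t : T t -> t \is unitarymx.
  move=> /(heisU hS)/unitarymxP; rewrite adj_tens tensmx_mul trmx1 map_mx1 mulmx1.
  by rewrite -(tens11 k p) => /(tens1_inj k0)/unitarymxP.
have YX : mxcomm Y X = omega R k.
  apply: mxcommE => //; try exact: (heisU hS).
  by rewrite /X /Y !tensmx_mul clock_shift tensZl.
have XY : mxcomm X Y = (omega R k)^-1 by rewrite (mxcommC kp0 hS)// YX.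
have selfc A : S A -> mxcomm A A = 1.
  by move=> SA; apply: mxcommE; rewrite ?scale1r//; exact: (heisU hS).
have Xk : X ^+ k = 1%:M by rewrite tensX clock_expr1 tens11.
have Yk : Y ^+ k = 1%:M by rewrite tensX shift_expr1 tens11.
have STP : S = [set A | exists h t, [/\ Hmat R k h, T t & A = h *t t]].
  apply/seteqP; split=> [s Ss|_ [h [t [[l [l1 [a [b ->]]]] Tt ->]]]]; last first.
    rewrite tensZl; apply: (heis_scale hS) => //.
    rewrite tensmx_decr -(mulmx1 (1%:M : 'M[C]_p)) -tensmx_mul -!tensX.
    by apply: (heisM hS) => //; apply: (heisM hS); exact: (heisX _ hS).
  have [i /esym si] := prim_rootP wP (mxcomm_exp kp0 hS Ss SX).
  have [j /esym sj] := prim_rootP wP (mxcomm_exp kp0 hS Ss SY).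
  have SYX : S (Y ^+ (k - i) *m X ^+ j) by apply: (heisM hS); exact: (heisX _ hS).
  (* The exponents k - i and j cancel the commutators of s with X and Y. *)
  pose s' := s *m (Y ^+ (k - i) *m X ^+ j).
  have Ss' : S s' by exact: (heisM hS).
  have ik : (i <= k)%N by exact: ltnW.
  have jk : (j <= k)%N by exact: ltnW.
  have s'X : mxcomm s' X = 1.
    rewrite (mxcommMl kp0 hS)// (mxcommMl kp0 hS)//; try exact: (heisX _ hS).
    rewrite !(mxcommXl kp0 hS)// YX -si selfc// expr1n mulr1 -exprD subnKC//.
    by rewrite omega_expr1.
  have s'Y : mxcomm s' Y = 1.
    rewrite (mxcommMl kp0 hS)// (mxcommMl kp0 hS)//; try exact: (heisX _ hS).
    rewrite !(mxcommXl kp0 hS)// XY -sj selfc// expr1n mul1r exprVn mulfV//.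
    by rewrite expf_neq0// -normr_eq0 omega_norm oner_eq0.
  have [t s't] : exists t : 'M[C]_p, s' = (1%:M : 'M[C]_k) *t t.
    apply: clock_shift_commutant => //.
      by rewrite /comm_mx (mxcommP kp0 hS Ss' SX) s'X scale1r.
    by rewrite /comm_mx (mxcommP kp0 hS Ss' SY) s'Y scale1r.
  have Tt : T t by rewrite /T /= -s't.
  exists (clock_mx R k ^+ (k - j) *m shift_mx R k ^+ i), t; split=> //.
    by exists 1; rewrite normr1; split=> //; exists (k - j)%N, i; rewrite scale1r.
  have : s = s' *m (X ^+ (k - j) *m Y ^+ i).
    rewrite /s' -!mulmxA (mulmxA (X ^+ j)) -mxpowD.
    rewrite subnKC// Xk mul1mx -mxpowD.
    by rewrite subnK// Yk mulmx1.
  by rewrite s't !tensX !tensmx_mul !mul1mx !mulmx1.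
exists T; split=> //; split=> //.
- move=> t t' Tt Tt'; have := heisM hS Tt Tt'.
  by rewrite tensmx_mul mul1mx.
- by move=> t /(heisV hS); rewrite adj_tens trmx1 map_mx1.
- move=> t t' Tt Tt'; have [c [h ck]] := heisC hS Tt Tt'.
  exists c; split=> //; apply: (tens1_inj k0).
  by move: h; rewrite !tensmx_mul mul1mx -tensZr.
- move=> u uu uT; apply: (heisZ hS).
    apply/unitarymxP; rewrite adj_tens tensmx_mul trmx1 map_mx1 mulmx1.
    by rewrite unitary_adjmxK// tens11.
  rewrite STP => _ [h [t [_ Tt ->]]].
  by rewrite /comm_mx !tensmx_mul mul1mx mulmx1 (uT t Tt).
Qed.

End TensorFactor.

(** * Classification of groups of Heisenberg type *)

Section Structure.
Variable R : realType.
Local Notation C := (Cplx R).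

Definition diag_torus m : set 'M[C]_m :=
  [set diag_mx d | d in [set d : 'rV[C]_m | forall i, `|d 0 i| = 1]].

(** The recursion follows that of [HTprod], so that this set is the preimage of
    the product when T is the preimage of the torus ([lifts_tens_map]). *)
Fixpoint tens_set m (T : set 'M[C]_m) (ns : seq nat) : set 'M[C]_(tens_dim m ns) :=
  if ns is k :: ns' return set 'M[C]_(tens_dim m ns)
  then [set A | exists h t, [/\ Hmat R k h, @tens_set m T ns' t & A = h *t t]]
  else T.
Arguments tens_set {m} T ns _.

Lemma isometric_tens k a b (G : 'M[C]_(a, b)) : isometric G ->
  isometric ((1%:M : 'M[C]_k) *t G).
Proof.
by move=> [GG GG']; split;
  rewrite adj_tens tensmx_mul trmx1 map_mx1 mulmx1 ?GG ?GG' tens11.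
Qed.

Lemma transport_tens k a b (G : 'M[C]_(a, b)) (T : set 'M[C]_b) :
  [set A | exists h t, [/\ Hmat R k h, transport G T t & A = h *t t]] =
  transport ((1%:M : 'M[C]_k) *t G)
    [set A | exists h t, [/\ Hmat R k h, T t & A = h *t t]].
Proof.
have e (h : 'M[C]_k) (t : 'M[C]_b) :
    ((1%:M : 'M[C]_k) *t G) *m (h *t t) *m ((1%:M : 'M[C]_k) *t G)^t* =
    h *t (G *m t *m G^t*).
  by rewrite adj_tens !tensmx_mul trmx1 map_mx1 mulmx1 mul1mx.
apply/seteqP; split=> [_ [h [_ [hH [t Tt <-] ->]]]|_ [_ [h [t [hH Tt ->]]] <-]].
  by exists (h *t t); [exists h, t|rewrite e].
by exists h, (G *m t *m G^t*); split=> //; exists t.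
Qed.

Lemma tens_set_transport m (P : 'M[C]_m) T ns : isometric P ->
  exists2 Q, isometric Q &
    tens_set (transport P T) ns = transport Q (tens_set T ns).
Proof.
move=> Pi; elim: ns => [|k ns [Q Qi IH]] /=; first by exists P.
exists ((1%:M : 'M[C]_k) *t Q); first exact: isometric_tens.
by rewrite IH transport_tens.
Qed.

Lemma tens_dimE m ns : tens_dim m ns = (\prod_(k <- ns) k * m)%N.
Proof.
elim: ns => [|k ns IH] /=; first by rewrite big_nil mul1n.
by rewrite big_cons IH mulnA.
Qed.

(** Classification of Heisenberg-type groups, by splitting off one clock and
    shift pair of largest order at a time. *)
Theorem heis_structure n (S : set 'M[C]_n) K :
  (0 < n)%N -> (0 < K)%N -> heis S K ->
  exists ns m (G : 'M[C]_(n, tens_dim m ns)),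
  [/\ isometric G, S = transport G (tens_set (@diag_torus m) ns),
      all (leq 2) ns, all (dvdn^~ K) ns & sorted (fun a b => b %| a)%N ns].
Proof.
elim/ltn_ind: n => n IH in S K * => n0 K0 hS.
have [k [x [y [Sx Sy kP allk]]]] := primitive_commutator n0 hS K0.
have hSk : heis S k.
  split; [exact: (heisU hS)|exact: (heisM hS)|exact: (heisV hS)| |exact: (heisZ hS)].
  by move=> A B SA SB; exists (mxcomm A B); split; [exact: (mxcommP n0 hS)|exact: allk].
have k0 := prim_order_gt0 kP.
have kK : (k %| K)%N.
  by rewrite (prim_order_dvd kP) (mxcomm_exp n0 hS)// eqxx.
have [k1|k2] : (k = 1 \/ 2 <= k)%N by case: (k) k0 => [|[|]]//; [left|right].
  have [|P [Pu SP]] := comm_heis_diag hS.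
    move=> A B SA SB; rewrite /comm_mx (mxcommP n0 hS SA SB).
    by have := allk _ _ SA SB; rewrite k1 expr1 => ->; rewrite scale1r.
  exists [::], n, (P^t*); split=> //.
    by apply: isometric_adj; exact/isometric_unitary.
  rewrite SP /= ; apply/seteqP; split=> [_ [d d1 <-]|_ [_ [d d1 <-] <-]].
    by exists (diag_mx d); [exists d|rewrite trmxCK].
  by exists d => //; rewrite trmxCK.
have wP := omega_prim R k0.
have w0 : omega R k != 0 by rewrite -normr_eq0 omega_norm oner_eq0.
(* A power of y replaces the primitive root mxcomm x y by the inverse of the
   standard one. *)
have [i xyi] : exists i, (omega R k)^-1 = mxcomm x y ^+ i.
  have [|i ->] := prim_rootP kP (_ : (omega R k)^-1 ^+ k = 1); last by exists i.
  by rewrite exprVn omega_expr1 invr1.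
have Syi := heisX i hS Sy.
have xyi' : mxcomm x (y ^+ i) = (omega R k)^-1.
  rewrite (mxcommC n0 hS Syi Sx) (mxcommXl n0 hS)// (mxcommC n0 hS Sx Sy).
  by rewrite exprVn invrK xyi.
have [|x' [Sx' x'k x'E]] := split_order n0 hS k0 Sx; first by move=> *; exact: allk.
have [|y' [Sy' y'k y'E]] := split_order n0 hS k0 Syi; first by move=> *; exact: allk.
have y'x' : y' *m x' = omega R k *: (x' *m y').
  rewrite (mxcommP n0 hS Sy' Sx') y'E// (mxcommC n0 hS Sx' Syi) x'E// xyi'.
  by rewrite invrK.
have [p [G [GG GG' GQ GP]]] := clock_shift_rep k0 (heisU hS Sx') (heisU hS Sy') x'k y'k y'x'.
have Gi : isometric G by [].
have nkp := isometry_square GG GG'.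
have p0 : (0 < p)%N by move: n0; rewrite nkp muln_gt0 => /andP[].
have [||T [hT ST]] := heis_tensor k0 p0 (heis_transport (isometric_adj Gi) hSk).
- by exists x' => //; rewrite trmxCK -mulmxA -GQ mulmxA GG' mul1mx.
- by exists y' => //; rewrite trmxCK -mulmxA -GP mulmxA GG' mul1mx.
have pn : (p < n)%N by rewrite nkp ltn_Pmull.
have [ns [m [H [Hi TH ns2 nsk nss]]]] := IH p pn T k p0 k0 hT.
exists (k :: ns), m, (G *m ((1%:M : 'M[C]_k) *t H)); split=> /=.
- by apply: isometricM => //; exact: isometric_tens.
- by rewrite transportM -transport_tens -TH -ST transportK.
- by rewrite k2.
- rewrite kK; apply: sub_all nsk => j jk; exact: dvdn_trans kK.
- rewrite path_sortedE ?nsk// => a b c ba cb; exact: dvdn_trans cb ba.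
Qed.

End Structure.
Arguments tens_set {R m} T ns _.
Arguments diag_torus {R m} _.

(** * Exponentials of skew-Hermitian matrices *)

Section MatrixLimits.

Lemma cvg_mx (U : topologicalType) (m n : nat) (I : Type) (F : set_system I)
  {FF : Filter F} (M : I -> 'M[U]_(m, n)) (L : 'M[U]_(m, n)) :
  (forall i j, (fun x => M x i j) @ F --> L i j) -> M @ F --> L.
Proof.
move=> ML A [P LP PA].
have : \forall x \near F, forall i j, P i j (M x i j).
  by apply: filter_forall => i; apply: filter_forall => j; apply: ML; exact: LP.
by apply: filterS => x /= Px; exact: PA.
Qed.

Variable R : realType.
Local Notation C := (Cplx R).

Lemma toC_continuous : continuous (@toC R).
Proof.
move=> x; apply/cvgrPdist_lt => e e0.
have [eR e0'] : e = toC (complex.Re e) /\ 0 < complex.Re e.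
  by case: e e0 => a b; rewrite ltcE /= => /andP[/eqP -> ->].
have xe : \forall y \near x, `|x - y| < complex.Re e.
  have := nbhsx_ballx x (complex.Re e) e0'.
  by apply: filterS => y; rewrite -ball_normE.
near=> y; have xy : `|x - y| < complex.Re e by near: y.
rewrite eR; have -> : toC x - toC y = toC (x - y) by rewrite /toC -rmorphB.
by rewrite /toC normc_def /= expr0n /= addr0 sqrtr_sqr ltcR.
Unshelve. all: by end_near. Qed.

Lemma cvg_toC (I : Type) (F : set_system I) (u : I -> R) (l : R) : Filter F ->
  u @ F --> l -> (fun x => toC (u x)) @ F --> toC l.
Proof. by move=> FF; apply: continuous_cvg; exact: toC_continuous. Qed.

Lemma ComplexE (a b : R) : Complex a b = toC a + Complex 0 1 * toC b :> C.
Proof.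
apply/eqP; rewrite eq_complex /= !mulr0 !mul0r !mul1r.
by apply/andP; split; apply/eqP; rewrite ?subr0 ?addr0 ?add0r.
Qed.

(** The even and odd terms of the exponential series at i * t are the terms of
    the cosine series and i times those of the sine series. *)
Lemma exp_series_cis (t : R) :
  series (fun k => (k`!%:R)^-1 * (Complex 0 t : C) ^+ k) @ \oo --> cis t.
Proof.
have coefE k : (k`!%:R)^-1 * (Complex 0 t : C) ^+ k =
    Complex (cos_coeff t k) (sin_coeff t k).
  have t2 : (Complex 0 t : C) ^+ 2 = toC (- t ^+ 2).
    by rewrite /toC expr2; congr Complex; ring.
  have evenE m : (Complex 0 t : C) ^+ m.*2 = toC ((-1) ^+ m * t ^+ m.*2).
    by rewrite -mul2n !exprM t2 /toC -rmorphXn /= -[- t ^+ 2]mulN1r exprMn.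
  have factE : (k`!%:R : C)^-1 = toC (k`!%:R)^-1 by rewrite /toC fmorphV rmorph_nat.
  rewrite factE -(odd_double_half k); move: (k./2) => m; case: (odd k) => /=.
    rewrite add1n exprS evenE cos_coeff_odd /sin_coeff /= odd_double /=.
    rewrite half_double exprS mul1r /toC; set f := _^-1.
    apply/eqP; rewrite eq_complex /=; apply/andP; split; apply/eqP; ring.
  rewrite add0n evenE sin_coeff_even /cos_coeff /= odd_double half_double mul1r -exprnP.
  rewrite /toC; set f := _^-1.
  apply/eqP; rewrite eq_complex /=; apply/andP; split; apply/eqP; ring.
have -> : series (fun k => (k`!%:R)^-1 * (Complex 0 t : C) ^+ k) =
    fun N => toC (series (cos_coeff t) N) + Complex 0 1 * toC (series (sin_coeff t) N).
  apply/funext => N; rewrite -ComplexE /series /=.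
  elim: N => [|N IH]; first by rewrite !big_geq.
  by rewrite !big_nat_recr //= IH coefE.
rewrite /cis ComplexE; apply: cvgD; first by apply: cvg_toC; rewrite cos.unlock; exact: is_cvg_series_cos_coeff.
apply: cvgM; first exact: cvg_cst.
by apply: cvg_toC; rewrite sin.unlock; exact: is_cvg_series_sin_coeff.
Qed.

Lemma expmx_diag n (P : 'M[C]_n) (t : 'rV[R]_n) : P \is unitarymx ->
  expmx (P^t* *m diag_mx (\row_j (Complex 0 (t 0 j) : C)) *m P) =
  P^t* *m diag_mx (\row_j cis (t 0 j)) *m P.
Proof.
move=> Pu; rewrite /expmx; set X := _ *m P.
pose z k j := (k`!%:R)^-1 * (Complex 0 (t 0 j) : C) ^+ k.
have XE k : (k`!%:R)^-1 *: X ^+ k = P^t* *m diag_mx (\row_j z k j) *m P.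
  by rewrite conj_diagX// conj_diagZ; apply: eq_conj_diag => j; rewrite !mxE.
have serE : series (fun k => (k`!%:R)^-1 *: X ^+ k) =
    fun N => P^t* *m diag_mx (\row_j series (z^~ j) N) *m P.
  apply/funext => N; elim: N => [|N IH].
    rewrite /series /= big_geq// -(conj_diag0 P); apply: eq_conj_diag => j.
    by rewrite !mxE big_geq.
  rewrite seriesSr IH XE conj_diagD; apply: eq_conj_diag => j.
  by rewrite !mxE seriesSr.
apply: cvg_lim; first exact: norm_hausdorff.
rewrite serE; apply: cvg_mx => i j.
have entry (d : 'rV[C]_n) : (P^t* *m diag_mx d *m P) i j =
    \sum_l (P^t* i l * d 0 l) * P l j.
  by rewrite mxE; apply: eq_bigr => l _; rewrite mul_mx_diag !mxE.
rewrite entry.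
rewrite (_ : (fun _ => _) = fun N => \sum_l (P^t* i l * series (z^~ l) N) * P l j).
  apply: cvg_big => [|l _]; first exact: add_continuous.
  apply: cvgM; last exact: cvg_cst.
  by apply: cvgM; [exact: cvg_cst|rewrite mxE; exact: exp_series_cis].
apply/funext => N; rewrite entry; apply: eq_bigr => l _.
by congr (_ * _ * _); rewrite mxE.
Qed.

End MatrixLimits.

(** * From the equality of dimensions to the centraliser property *)

Section Lifts.
Variable R : realType.
Local Notation C := (Cplx R).

(** The preimage in U(n) of a subset of PU(n).  Its members are matrices rather
    than bundled unitaries so that rectangular isometries can act on it. *)
Definition lifts n (F : set (PU R n)) : set 'M[C]_n :=
  [set A | exists2 u : unitary R n, umx u = A & F (pcl u)].

Lemma lifts_umx n F (u : unitary R n) : lifts F (umx u) <-> F (pcl u).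
Proof.
split=> [[v vu Fv]|Fu]; last by exists u.
by suff <- : pcl v = pcl u by []; apply/pclE; exists 1; rewrite ?normr1 ?scale1r.
Qed.

Lemma lifts_inj n (F F' : set (PU R n)) : lifts F = lifts F' -> F = F'.
Proof.
move=> FF'; apply/funext; elim/PU_ind => u; apply/propext.
by rewrite -!lifts_umx FF'.
Qed.

Lemma lifts_unitary n F (A : 'M[C]_n) : lifts F A -> A \is unitarymx.
Proof. by move=> [u <- _]; exact: umxP. Qed.

Lemma lifts_scale n F (A : 'M[C]_n) (l : C) : `|l| = 1 -> lifts F A -> lifts F (l *: A).
Proof.
move=> l1 [u <- Fu]; have lu := scale_unitarymx l1 (umxP u).
exists (Unitary lu) => //; suff -> : pcl (Unitary lu) = pcl u by [].
by apply/pclE; exists l.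
Qed.

Lemma AdE n (a : unitary R n) X : Ad (pcl a) X = umx a *m X *m (umx a)^t*.
Proof.
have [k k1 ek] := (pclE (repr (pcl a)) a).1 (reprK _).
rewrite /Ad ek adjmxZ -!scalemxAl -scalemxAr scalerA -normCK k1 expr1n.
by rewrite scale1r.
Qed.

Lemma Ad_fixedP n (a : unitary R n) X :
  Ad (pcl a) X = X <-> comm_mx (umx a) X.
Proof.
rewrite AdE; split=> [h|h].
  by rewrite /comm_mx -{2}h -mulmxA unitary_adjKmx ?umxP// mulmx1.
by rewrite h -mulmxA unitary_adjmxK ?umxP// mulmx1.
Qed.

Lemma group_divE (G : groupType) (S : set G) : is_subgroup S ->
  [/\ S 1%g, (forall x, S x -> S x^-1%g) & (forall x y, S x -> S y -> S (x * y)%g)].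
Proof.
move=> [S1 Sd]; have SV x : S x -> S x^-1%g.
  by move=> Sx; rewrite -[(x^-1)%g]mul1g; exact: Sd.
by split=> // x y Sx Sy; rewrite -[y]invgK; apply: Sd => //; exact: SV.
Qed.

Lemma pclM n (a b : unitary R n) : (pcl a * pcl b)%g = pcl (a * b)%g.
Proof. exact: PUME. Qed.

Lemma pclV n (a : unitary R n) : (pcl a)^-1%g = pcl (a^-1)%g.
Proof. exact: PUVE. Qed.

Lemma pcl_commute n (a b : unitary R n) : commute (pcl a) (pcl b) <->
  exists2 l : C, `|l| = 1 & umx a *m umx b = l *: (umx b *m umx a).
Proof. by rewrite /commute !pclM; exact: pclE. Qed.

(** Taking determinants leaves only the n-th power of the scalar. *)
Lemma scalar_commutator_exp n (A B : 'M[C]_n) (c : C) :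
  A \is unitarymx -> B \is unitarymx -> A *m B = c *: (B *m A) -> c ^+ n = 1.
Proof.
move=> Au Bu /(congr1 determinant); rewrite detZ !det_mulmx [\det B * _]mulrC.
have d0 : \det A * \det B != 0.
  by rewrite mulf_neq0// -unitfE -unitmxE unitarymx_unit.
by rewrite -{1}[_ * _]mul1r => /(mulIf d0).
Qed.

End Lifts.

Section LieAlgebraOfF.
Variable R : realType.
Local Notation C := (Cplx R).

(** The matrix expressing a basis of V in a basis of W is square and injective,
    so it is invertible. *)
Lemma real_dim_subset_eq n (V W : set 'M[C]_n) d :
  has_real_dim V d -> has_real_dim W d -> V `<=` W -> W `<=` V.
Proof.
move=> [B [VB Bfree]] [B' [WB' B'free]] VW.
have VBi i : V (B i).
  rewrite VB; exists (fun j => (j == i)%:R).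
  rewrite (bigD1 i)//= big1 => [|j /negbTE ->].
    by rewrite eqxx addr0 /toC rmorph1 scale1r.
  by rewrite /toC rmorph0 scale0r.
have /choice[M MB] : forall i, exists c : 'I_d -> R, B i = \sum_j toC (c j) *: B' j.
  by move=> i; have := VW _ (VBi i); rewrite WB'.
pose N := \matrix_(i, j) M i j.
have sumE (e : 'rV[R]_d) : \sum_i toC (e 0 i) *: B i =
    \sum_j toC ((e *m N) 0 j) *: B' j.
  under eq_bigr do rewrite MB scaler_sumr.
  rewrite exchange_big /=; apply: eq_bigr => j _.
  rewrite mxE /toC rmorph_sum /= scaler_suml; apply: eq_bigr => i _.
  by rewrite scalerA mxE rmorphM.
have Nu : N \in unitmx.
  rewrite -row_free_unit -kermx_eq0; apply/eqP/row_matrixP => i.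
  rewrite row0; set e := row i _.
  have eN : e *m N = 0 by apply/sub_kermxP; exact: row_sub.
  apply/rowP => j; rewrite [RHS]mxE; apply: (Bfree (fun j => e 0 j)).
  rewrite sumE eN big1// => l _; rewrite mxE /toC rmorph0 scale0r//.
move=> X; rewrite WB' => -[c ->]; rewrite VB.
exists (fun i => ((\row_j c j) *m invmx N) 0 i); rewrite sumE mulmxKV//.
by apply: eq_bigr => j _; rewrite mxE.
Qed.

Lemma skew_spectral n (X : 'M[C]_n) : X^t* = - X ->
  exists P : 'M[C]_n, P \is unitarymx /\
  exists t : 'rV[R]_n, X = P^t* *m diag_mx (\row_j (Complex 0 (t 0 j) : C)) *m P.
Proof.
move=> Xs; have Xn : X \is normalmx by apply/normalmxP; rewrite Xs mulmxN mulNmx.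
have [P [Pu [d Xd]]] := normal_spectral Xn; exists P; split=> //.
exists (\row_j complex.Im (d 0 j)); rewrite Xd; apply: eq_conj_diag => j.
have dN : diag_mx (map_mx Num.conj d) = - diag_mx d.
  rewrite -adj_diag_mx -(conj_diagK d Pu) -Xd !adjmxM trmxCK Xs mulmxA.
  by rewrite mulmxN mulNmx.
move/matrixP/(_ j j): dN; rewrite !mxE eqxx !mulr1n.
case: (d 0 j) => a b /eqP; rewrite eq_complex /= => /andP[/eqP aN _].
by have /eqP := esym aN; rewrite eqNr => /eqP ->.
Qed.

Lemma cis_inj (x y : R) : `|x| < 1 -> `|y| < 1 -> cis x = cis y -> x = y.
Proof.
move=> x1 y1 [_ sxy]; have pi2 := @pihalf_ge1 R.
have y1' : y \in `[- (pi / 2), pi / 2].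
  by rewrite in_itv /=; move: y1; rewrite ltr_norml => /andP[]; lra.
have x1' : x \in `[- (pi / 2), pi / 2].
  by rewrite in_itv /=; move: x1; rewrite ltr_norml => /andP[]; lra.
exact: sin_inj.
Qed.

Lemma norm1_cis : exists arg : C -> R, forall z : C, `|z| = 1 -> z = cis (arg z).
Proof.
suff h : forall z : C, exists t : R, `|z| = 1 -> z = cis t.
  by have [arg argP] := choice h; exists arg.
move=> [a b]; have [z1|z1] := pselect (`|Complex a b : C| = 1); last by exists 0.
have ab : a ^+ 2 + b ^+ 2 = 1.
  move: z1; rewrite normc_def /= => -[sq1].
  by rewrite -[LHS]sqr_sqrtr ?sq1 ?expr1n// addr_ge0 ?sqr_ge0.
have a1 : -1 <= a <= 1.
  by rewrite -ler_norml -(@ler_pXn2r _ 2)// ?nnegrE// real_normK ?num_real// expr1n -ab lerDl sqr_ge0.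
have sE : Num.sqrt (1 - a ^+ 2) = `|b|.
  by rewrite -ab addrAC subrr add0r sqrtr_sqr.
have [b0|b0] := leP 0 b.
  by exists (acos a) => _; rewrite /cis acosK ?in_itv// sin_acos// sE ger0_norm.
by exists (- acos a) => _; rewrite /cis cosN sinN acosK ?in_itv// sin_acos// sE ltr0_norm// opprK.
Qed.

(** If a commutes with exp(tX) up to a scalar then the scalar is 1 for small t,
    because exp(tX) has non-zero trace; and for small t the matrices X and
    exp(tX) have the same commutant. *)
Lemma lie_sub_fixed n (F : set (PU R n)) : (0 < n)%N -> is_abelian F ->
  lie_sub F `<=` lie_fixed F.
Proof.
move=> n0 Fab X [XL XF]; split=> //; elim/PU_ind => a Fa; apply/Ad_fixedP.
have [P [Pu [t XE]]] := skew_spectral XL.1.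
(* Scaling by s brings all angles below 1, where cosines are positive and
   sines are injective. *)
pose D := 1 + \sum_j `|t 0 j|; pose s := D^-1.
have D0 : 0 < D by rewrite ltr_pwDl// sumr_ge0.
have s0 : 0 < s by rewrite invr_gt0.
have small j : `|s * t 0 j| < 1.
  rewrite normrM gtr0_norm// mulrC ltr_pdivrMr// mul1r.
  have rest : 0 <= \sum_(i | i != j) `|t 0 i| by exact: sumr_ge0.
  by rewrite /D (bigD1 j)//= addrCA ltrDl; exact: ltr_pwDl.
have [A AE FA] := XF s.
have sXE : toC s *: X = P^t* *m diag_mx (\row_j (Complex 0 ((s *: t) 0 j) : C)) *m P.
  rewrite XE conj_diagZ; apply: eq_conj_diag => j; rewrite !mxE; apply/eqP; rewrite eq_complex /=.
  by apply/andP; split; apply/eqP; ring.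
rewrite sXE expmx_diag// in AE.
have trA : \tr (umx A) != 0.
  rewrite AE mxtrace_mulC mulmxA unitary_adjmxK// mul1mx mxtrace_diag.
  suff : 0 < complex.Re (\sum_i (\row_j cis ((s *: t) 0 j)) 0 i).
    by apply: contraTneq => ->; rewrite ltxx.
  rewrite raddf_sum; have o : 'I_n := Ordinal n0.
  have Re0 i : 0 < complex.Re ((\row_j cis ((s *: t) 0 j)) 0 i).
    rewrite !mxE /=; apply: cos_gt0_pihalf; have := @pi_ge2 R.
    by move: (small i); rewrite ltr_norml => /andP[]; lra.
  rewrite (bigD1 (Ordinal n0))//= ltr_pwDl// sumr_ge0// => i _; exact: ltW.
have [l l1 aA] := (pcl_commute a A).1 (Fab _ _ Fa FA).
have l1' : l = 1.
  have /(congr1 (fun X => \tr (X *m (umx a)^t*))) := aA.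
  rewrite -scalemxAl mxtraceZ mxtrace_mulC mulmxA unitary_adjKmx ?umxP// mul1mx.
  rewrite -mulmxA unitary_adjmxK ?umxP// mulmx1.
  by rewrite -{1}[\tr _]mul1r => /(mulIf trA).
rewrite l1' scale1r AE in aA.
rewrite XE; apply: comm_spectral_fun aA => // i j.
rewrite !mxE => /cis_inj st; congr Complex.
by apply: (mulfI (lt0r_neq0 s0)); exact: st.
Qed.

(** The dimension hypothesis forces F to contain the classes of all unitary
    matrices commuting with its lifts: such a matrix is the exponential of a
    skew-Hermitian matrix commuting with F, hence of an element of the Lie
    algebra of F. *)
Lemma heis_lifts n (F : set (PU R n)) : (0 < n)%N ->
  is_subgroup F -> is_abelian F -> dim_fixed_eq_dim F -> heis (lifts F) n.
Proof.
move=> n0 /group_divE[F1 FV FM] Fab [d [fixd subd]].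
have fix_sub : lie_fixed F `<=` lie_sub F.
  exact: (real_dim_subset_eq subd fixd (lie_sub_fixed n0 Fab)).
split; first exact: lifts_unitary.
- move=> _ _ [u <- Fu] [v <- Fv]; exists (u * v)%g => //.
  by rewrite -pclM; exact: FM.
- by move=> _ [u <- Fu]; exists (u^-1)%g => //; rewrite -pclV; exact: FV.
- move=> _ _ [u <- Fu] [v <- Fv].
  have [l l1 uv] := (pcl_commute u v).1 (Fab _ _ Fu Fv).
  by exists l; split=> //; apply: scalar_commutator_exp uv; exact: umxP.
- move=> u uu uF; have [P [Pu [f [uE f1]]]] := unitary_spectral uu.
  have [arg argE] := norm1_cis; pose t j := arg (f 0 j).
  have tE j : f 0 j = cis (t j) by exact: argE.
  (* Subtracting the mean makes X traceless and changes exp X by a scalar. *)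
  pose mu := (\sum_j t j) / n%:R.
  pose th := \row_j (t j - mu).
  pose X := P^t* *m diag_mx (\row_j (Complex 0 (th 0 j) : C)) *m P.
  have Xskew : X^t* = - X.
    rewrite /X conj_diag_adj -scaleN1r conj_diagZ; apply: eq_conj_diag => j.
    rewrite !mxE mulN1r.
    by apply/eqP; rewrite eq_complex /= oppr0 !eqxx.
  have Xtr : \tr X = 0.
    rewrite /X mxtrace_mulC mulmxA unitary_adjmxK// mul1mx mxtrace_diag.
    have -> : \sum_i (\row_j (Complex 0 (th 0 j) : C)) 0 i =
        Complex 0 1 * toC (\sum_i th 0 i).
      rewrite /toC rmorph_sum mulr_sumr; apply: eq_bigr => j _; rewrite mxE.
      by apply/eqP; rewrite eq_complex /=; apply/andP; split; apply/eqP; ring.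
    under eq_bigr do rewrite mxE.
    rewrite sumrB sumr_const card_ord -[mu *+ _]mulr_natr divfK ?subrr ?pnatr_eq0 -?lt0n//.
    by rewrite /toC rmorph0 mulr0.
  have XF : lie_fixed F X.
    split=> //; elim/PU_ind => a Fa; apply/Ad_fixedP.
    have : comm_mx (umx a) u by apply/esym/uF; exists a.
    by rewrite uE; apply: comm_spectral_fun => // i j; rewrite !mxE /t => ->.
  have [_ /(_ 1)[A AE FA]] := fix_sub _ XF.
  rewrite {1}/toC rmorph1 scale1r expmx_diag// in AE.
  have uA : u = cis mu *: umx A.
    rewrite AE uE conj_diagZ; apply: eq_conj_diag => j; rewrite !mxE -cisD tE.
    by congr cis; lra.
  by rewrite uA; apply: lifts_scale; [exact: norm_cis|exists A].
Qed.

End LieAlgebraOfF.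

(** * Lifts of tensor products and of conjugates *)

Section LiftsOfProducts.
Variable R : realType.
Local Notation C := (Cplx R).

Lemma lifts_pclE n (F : set (PU R n)) (u : unitary R n) (A : 'M[C]_n) (l : C) :
  `|l| = 1 -> A = l *: umx u -> lifts F A <-> F (pcl u).
Proof.
move=> l1 Au; rewrite -lifts_umx Au; split=> [h|]; last exact: lifts_scale.
have -> : umx u = l^-1 *: (l *: umx u).
  by rewrite scalerA mulVf ?scale1r// -normr_eq0 l1 oner_eq0.
by apply: lifts_scale => //; rewrite normfV l1 invr1.
Qed.

Lemma umxX n (u : unitary R n) a : umx (u ^+ a)%g = umx u ^+ a.
Proof.
elim: a => [|a IH]; first by rewrite expr0.
by rewrite expgS mxpowS -IH.
Qed.

Lemma lifts_Hgroup k : (0 < k)%N -> lifts (Hgroup R k) = Hmat R k.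
Proof.
move=> k0; set q := Unitary (clock_mxP R k); set p := Unitary (shift_mxP R k).
have /group_divE[H1 HV HM] : is_subgroup (Hgroup R k).
  split; first by move=> S [[]].
  by move=> x y Hx Hy S [Sg Ss]; apply: (Sg.2); [exact: Hx|exact: Hy].
have HX x a : Hgroup R k x -> Hgroup R k (x ^+ a)%g.
  by move=> Hx; elim: a => [|a IH]; rewrite ?expg0// expgS; exact: HM.
have Hq : Hgroup R k (pcl q) by move=> S [_]; apply; left.
have Hp : Hgroup R k (pcl p) by move=> S [_]; apply; right.
have pclX (u : unitary R k) a : (pcl u ^+ a)%g = pcl (u ^+ a)%g.
  elim: a => [|a IH]; first by rewrite !expg0.
  by rewrite !expgS IH pclM.
apply/seteqP; split=> [_ [u <- Hu]|A [l [l1 [a [b AE]]]]]; last first.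
  have AE' : A = l *: umx (q ^+ a * p ^+ b)%g by rewrite AE /= !umxX.
  apply/(lifts_pclE _ l1 AE'); rewrite -pclM -!pclX.
  by apply: HM; exact: HX.
pose S := [set x : PU R k | exists a b, x = (pcl q ^+ a * pcl p ^+ b)%g].
have : S (pcl u).
  apply: Hu; split.
    split; first by exists 0%N, 0%N; rewrite !expg0 mulg1.
    have qp : commute (pcl q) (pcl p).
      apply/commute_sym/pcl_commute; exists (omega R k); first exact: omega_norm.
      exact: clock_shift.
    have qk : (pcl q ^+ k)%g = 1%g.
      rewrite pclX; congr pcl; apply: val_inj; rewrite /= umxX.
      exact: clock_expr1.
    have pk : (pcl p ^+ k)%g = 1%g.
      rewrite pclX; congr pcl; apply: val_inj; rewrite /= umxX.
      exact: shift_expr1.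
    move=> _ _ [a [b ->]] [c [d ->]].
    exists (a + k.-1 * c)%N, (b + k.-1 * d)%N; apply: (canLR (mulgK _)).
    have cancel_exp (x : PU R k) e f : (x ^+ k = 1 ->
        x ^+ (e + k.-1 * f) * x ^+ f = x ^+ e)%g.
      move=> xk; rewrite -expgnDr -addnA -mulSnr prednK// expgnDr expgnA xk.
      by rewrite expg1n mulg1.
    set x := (pcl q ^+ (_ + _))%g; set y := (pcl p ^+ (_ + _))%g.
    have yq : (y * pcl q ^+ c = pcl q ^+ c * y)%g by apply/esym/commuteX2.
    rewrite mulgA -(mulgA x) yq (mulgA x) -(mulgA _ y).
    by congr (_ * _)%g; apply/esym; exact: cancel_exp.
  move=> x [->|->]; first by exists 1%N, 0%N; rewrite expg1 expg0 mulg1.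
  by exists 0%N, 1%N; rewrite expg1 expg0 mul1g.
move=> [a [b]]; rewrite !pclX pclM => /pclE[l l1 ->].
by exists l; split=> //; exists a, b; rewrite /= !umxX.
Qed.

Lemma lifts_tens k p (H : set (PU R k)) (T : set (PU R p)) :
  lifts [set z | exists x y, [/\ H x, T y & z = tensPU x y]] =
  [set A | exists h t, [/\ lifts H h, lifts T t & A = h *t t]].
Proof.
apply/seteqP; split=> [_ [u <- [x [y [Hx Ty]]]]|_ [_ [_ [[a <- Ha] [b <- Tb] ->]]]].
  elim/PU_ind: x Hx => a Ha; elim/PU_ind: y Ty => b Tb.
  rewrite tensPUE => /pclE[l l1 ->].
  exists (l *: umx a), (umx b); split; last by rewrite tensZl.
    by apply: lifts_scale => //; exists a.
  by exists b.
by exists (tensU a b) => //; exists (pcl a), (pcl b); rewrite tensPUE.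
Qed.

Lemma lifts_tens_map m (T : set (PU R m)) ns : all (leq 2) ns ->
  lifts [set tens_map x | x in HTprod ns T] = tens_set (lifts T) ns.
Proof.
elim: ns => [_|k ns IH /= /andP[k2 ns2]] /=; first by rewrite image_id.
rewrite -lifts_Hgroup; last exact: ltnW.
rewrite -IH// -lifts_tens; congr lifts.
apply/seteqP; split=> [_ [[x y] [/= Hx Ty] <-]|_ [x [_ [Hx [y Ty <-] ->]]]].
  by exists x, (tens_map y); split=> //; exists y.
by exists (x, y).
Qed.

Lemma unitary_scalar_norm n (c : C) : (0 < n)%N ->
  (c%:M : 'M[C]_n) \is unitarymx -> `|c| = 1.
Proof.
move=> n0; rewrite -diag_const_mx => /diag_mx_unitaryP/(_ (Ordinal n0)).
by rewrite mxE.
Qed.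

Lemma tens_scalar_factors k p (A : 'M[C]_k) (B : 'M[C]_p) (l : C) :
  (0 < k)%N -> (0 < p)%N -> l != 0 -> A *t B = l%:M ->
  (exists c, A = c%:M) /\ (exists c, B = c%:M).
Proof.
move=> k0 p0 l0 /matrixP AB.
have ABE i i' j j' : A i i' * B j j' = l *+ ((i == i') && (j == j')).
  have := AB (mxtens_index (i, j)) (mxtens_index (i', j')).
  by rewrite tensmxE mxE (can_eq (@mxtens_indexK _ _)).
have AB0 i j : A i i * B j j != 0 by rewrite ABE !eqxx.
pose i0 := Ordinal k0; pose j0 := Ordinal p0.
have [A0 B0] : A i0 i0 != 0 /\ B j0 j0 != 0.
  by move: (AB0 i0 j0); rewrite mulf_eq0 negb_or => /andP.
split; [exists (A i0 i0)|exists (B j0 j0)]; apply/matrixP => i j; rewrite mxE.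
  apply: (mulIf B0); rewrite ABE eqxx andbT.
  by have [_|_] := eqVneq i j; rewrite ?mulr0n ?mul0r// !mulr1n ABE !eqxx.
apply: (mulfI A0); rewrite ABE eqxx /=.
by have [_|_] := eqVneq i j; rewrite ?mulr0n ?mulr0// !mulr1n ABE !eqxx.
Qed.

Lemma tensPU_inj k p (x x' : PU R k) (y y' : PU R p) : (0 < k)%N -> (0 < p)%N ->
  tensPU x y = tensPU x' y' -> x = x' /\ y = y'.
Proof.
move=> k0 p0; elim/PU_ind: x => a; elim/PU_ind: x' => a'.
elim/PU_ind: y => b; elim/PU_ind: y' => b'; rewrite !tensPUE => /pclE[l l1 /= ab].
have l0 : l != 0 by rewrite -normr_eq0 l1 oner_eq0.
have pcl_eq n (u u' : unitary R n) : (0 < n)%N ->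
    (exists c, (umx u')^t* *m umx u = c%:M) -> pcl u = pcl u'.
  move=> n0 [c uc]; apply/pclE; exists c.
    apply: (unitary_scalar_norm n0); rewrite -uc.
    by apply: mul_unitarymx; rewrite ?trmxC_unitary umxP.
  rewrite -mul_scalar_mx -scalar_mxC -uc mulmxA unitary_adjmxK ?umxP//.
  by rewrite mul1mx.
have [|] := @tens_scalar_factors k p ((umx a')^t* *m umx a) ((umx b')^t* *m umx b) l k0 p0 l0.
  rewrite -tensmx_mul -adj_tens ab -scalemxAr adj_tens tensmx_mul.
  by rewrite !unitary_adjKmx ?umxP// tens11 scalemx1.
by move=> /(pcl_eq _ _ _ k0)-> /(pcl_eq _ _ _ p0)->.
Qed.

Lemma tens_map_inj m ns : (0 < tens_dim m ns)%N ->
  injective (@tens_map R m ns).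
Proof.
elim: ns => [_ ? ?//|k ns IH /=]; rewrite muln_gt0 => /andP[k0 p0].
by move=> [x y] [x' y'] /= /(tensPU_inj k0 p0)[-> /(IH p0) ->].
Qed.

Lemma lifts_conj_set n (g : unitary R n) (F : set (PU R n)) :
  lifts (conj_set (pcl g) F) = transport (umx g) (lifts F).
Proof.
have conjE v : (pcl g * pcl v * (pcl g)^-1)%g = pcl (g * v * g^-1)%g.
  by rewrite pclV (pclM g v) (pclM (g * v)%g).
apply/seteqP; split=> [_ [u <- [x Fx]]|_ [_ [u <- Fu] <-]].
  elim/PU_ind: x Fx => v Fv; rewrite conjE => /esym/pclE[l l1 uE].
  exists (l *: umx v); first by apply: lifts_scale => //; exists v.
  by rewrite uE mulmx_scale_mid.
exists (g * u * g^-1)%g; first by [].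
by exists (pcl u) => //; rewrite conjE.
Qed.

(** Conjugacy in terms of lifts: letting the type of G be rectangular absorbs
    the cast along e. *)
Lemma transport_conj_set n n' (e : n' = n) (F : set (PU R n)) (Z : set (PU R n')) :
  (exists2 G : 'M[C]_(n, n'), isometric G & lifts F = transport G (lifts Z)) <->
  (exists g : PU R n, conj_set g F = [set castPU e z | z in Z]).
Proof.
destruct e; rewrite /castPU /= image_id; split=> [[G Gi FZ]|[g]].
  exists (pcl (Unitary (proj1 (isometric_unitary _) (isometric_adj Gi)))).
  apply: lifts_inj; rewrite lifts_conj_set /= FZ.
  by rewrite -{2}[G]trmxCK transportK// trmxCK; case: Gi.
elim/PU_ind: g => g FZ; exists ((umx g)^t*).
  exact/isometric_adj/isometric_unitary/umxP.
by rewrite -FZ lifts_conj_set -{2}[umx g]trmxCK transportK// trmxCK unitary_adjKmx ?umxP.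
Qed.

End LiftsOfProducts.

(** * Tori in the projective unitary group *)

Section DiagonalTorus.
Variable R : realType.
Local Notation C := (Cplx R).

Definition diag_PU m : set (PU R m) :=
  [set x | exists2 u : unitary R m, pcl u = x & diag_torus (umx u)].

Lemma lifts_diag_PU m : lifts (@diag_PU m) = diag_torus.
Proof.
apply/seteqP; split=> [_ [u <- [v /esym/pclE[l l1 ->] [d d1 <-]]]|_ [d d1 <-]].
  by exists (l *: d); [move=> j; rewrite mxE normrM l1 d1 mulr1|rewrite linearZ].
have du : diag_mx d \is unitarymx by apply/diag_mx_unitaryP.
by exists (Unitary du) => //; exists (Unitary du) => //; exists d.
Qed.

(** U(1)^(m-1) parametrises the classes of diagonal matrices, by normalising
    the first entry to 1. *)
Definition unit_head m (z : 'rV[C]_m) : 'rV[C]_m.+1 :=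
  \row_i (if unlift ord0 i is Some j then z 0 j else 1).

Lemma unit_head0 m (z : 'rV[C]_m) : unit_head z 0 ord0 = 1.
Proof. by rewrite mxE unlift_none. Qed.

Lemma unit_head_lift m (z : 'rV[C]_m) j : unit_head z 0 (lift ord0 j) = z 0 j.
Proof. by rewrite mxE liftK. Qed.

Lemma diag_unit_head m (z : 'rV[C]_m) : @circles R m z ->
  diag_mx (unit_head z) \is unitarymx.
Proof.
move=> z1; apply/diag_mx_unitaryP => i; rewrite mxE.
by case: (unlift ord0 i) => [j|]; [exact: z1|rewrite normr1].
Qed.

Lemma unit_head_continuous m : continuous (@unit_head m).
Proof.
move=> z; apply: (@cvg_mx _ _ _ _ (nbhs z) (nbhs_filter z)) => i j; rewrite mxE.
rewrite (_ : (fun x => _) = fun x : 'rV[C]_m => if unlift ord0 j is Some l then x 0 l else 1).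
  by case: (unlift ord0 j) => [l|]; [exact: coord_continuous|exact: cvg_cst].
by apply/funext => x; rewrite mxE.
Qed.

Lemma diag_mx_continuous m : continuous (@diag_mx C m).
Proof.
move=> z; apply: (@cvg_mx _ _ _ _ (nbhs z) (nbhs_filter z)) => i j; rewrite mxE.
rewrite (_ : (fun x => _) = fun x : 'rV[C]_m => x 0 i *+ (i == j)).
  exact: cvgMn (@coord_continuous C 1 m 0 i z).
by apply/funext => x; rewrite mxE.
Qed.

Lemma pcl_continuous m : continuous (@pcl R m).
Proof. exact: pi_continuous. Qed.

Lemma diag_PU_torus m : (0 < m)%N -> is_torus m.-1 (@diag_PU m).
Proof.
case: m => // m _; rewrite [m.+1.-1]/=.
have [h hE] : exists h : 'rV[C]_m -> unitary R m.+1,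
    forall z, @circles R m z -> umx (h z) = diag_mx (unit_head z).
  exists (fun z => insubd (unitary1 R m.+1) (diag_mx (unit_head z))) => z z1.
  by rewrite -[umx _]/(val _) insubdK//; exact: diag_unit_head.
exists (fun z => pcl (h z)); split.
- have hc : {within @circles R m, continuous h}.
    apply: continuous_comp_initial.
    apply: (@subspace_eq_continuous _ _ _ (@diag_mx C m.+1 \o @unit_head m)).
      by move=> z /set_mem z1 /=; rewrite hE.
    apply: continuous_subspaceT => z; apply: continuous_comp.
      exact: unit_head_continuous.
    exact: diag_mx_continuous.
  by move=> z; apply: continuous_comp; [exact: hc|exact: pcl_continuous].
- move=> z w z1 w1.
  have zw1 : @circles R m (map2_mx *%R z w).
    by move=> j; rewrite mxE normrM z1 w1 mulr1.
  have hM : h (map2_mx *%R z w) = (h z * h w)%g.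
    apply: val_inj; rewrite -[LHS]/(umx _) -[RHS]/(umx _ *m umx _).
    rewrite (hE _ z1) (hE _ w1) (hE _ zw1) mulmx_diag.
    congr diag_mx; apply/rowP => j; rewrite !mxE.
    by case: unliftP => [i _|_]; rewrite ?mxE ?mulr1.
  by rewrite hM; exact/esym/pclM.
- move=> z w /set_mem z1 /set_mem w1 /pclE[l _]; rewrite (hE _ z1) (hE _ w1).
  move=> /matrixP zw.
  have {}zw j : unit_head z 0 j = l * unit_head w 0 j.
    by have := zw j j; rewrite 3!mxE eqxx 2!mxE eqxx !mulr1n.
  have l1 : l = 1 by have := zw ord0; rewrite !unit_head0 mulr1.
  apply/rowP => j; have := zw (lift ord0 j).
  by rewrite !unit_head_lift l1 mul1r.
- apply/seteqP; split=> [_ [z z1 <-]|_ [u <- [d d1 du]]].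
    exists (h z) => //; rewrite (hE _ z1); exists (unit_head z) => //.
    by apply/diag_mx_unitaryP; exact: diag_unit_head.
  pose z : 'rV[C]_m := \row_j (d 0 (lift ord0 j) / d 0 ord0).
  have z1 : @circles R m z by move=> j; rewrite mxE normf_div !d1 divr1.
  exists z => //; apply/esym/pclE; exists (d 0 ord0); first exact: d1.
  rewrite (hE _ z1) -linearZ -du /=; congr diag_mx; apply/rowP => i; rewrite mxE.
  have d0 : d 0 ord0 != 0 by rewrite -normr_eq0 d1 oner_eq0.
  case: (unliftP ord0 i) => [j ->|->]; last by rewrite unit_head0 mulr1.
  by rewrite unit_head_lift mxE mulrC divfK.
Qed.

Lemma scalar_commX n (A B : 'M[C]_n) (c : C) e :
  A *m B = c *: (B *m A) -> A ^+ e *m B = c ^+ e *: (B *m A ^+ e).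
Proof.
move=> AB; elim: e => [|e IH]; first by rewrite !expr0 scale1r mul1mx mulmx1.
rewrite mxpowSr -mulmxA AB -scalemxAr (mulmxA (A ^+ e)) IH -scalemxAl scalerA -exprS.
by rewrite -mulmxA.
Qed.

Lemma torus_subgroup m d (T : set (PU R m)) : is_torus d T -> is_subgroup T.
Proof.
move=> [f [_ fM _ fT]].
pose one : 'rV[C]_d := const_mx 1.
have one1 : @circles R d one by move=> j; rewrite mxE normr1.
have fone : f one = 1%g.
  have := fM _ _ one1 one1; rewrite (_ : map2_mx _ _ _ = one); last first.
    by apply/rowP => j; rewrite !mxE mulr1.
  by move=> /(congr1 (fun x => (f one)^-1 * x)%g); rewrite mulKg mulVg.
split; first by rewrite -fT; exists one.
rewrite -fT => _ _ [z z1 <-] [w w1 <-].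
pose w' : 'rV[C]_d := \row_j (w 0 j)^-1.
have w'1 : @circles R d w' by move=> j; rewrite mxE normfV w1 invr1.
exists (map2_mx *%R z w').
  by move=> j; rewrite mxE normrM z1 w'1 mulr1.
have fVE : f w' = (f w)^-1%g.
  apply: (mulgI (f w)); rewrite mulgV -fone -fM//; congr f.
  by apply/rowP => j; rewrite !mxE mulfV// -normr_eq0 w1 oner_eq0.
by rewrite fM// fVE.
Qed.

(** A torus is divisible, and a commutator of lifts, being an m-th root of
    unity depending multiplicatively on each argument, is trivial on m-th
    powers.  So the lifts of a torus commute. *)
Lemma torus_lifts_commute m d (T : set (PU R m)) : (0 < m)%N ->
  is_torus d T -> forall A B, lifts T A -> lifts T B -> comm_mx A B.
Proof.
move=> m0 [f [_ fM _ fT]] _ _ [a <- Ta] [b <- Tb].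
move: Ta Tb; rewrite -!fT => -[z z1 za] [w w1 wb].
pose r (e : nat) : 'rV[C]_d := \row_j (m.-root (z 0 j)) ^+ e.
have r1 e : @circles R d (r e).
  move=> j; rewrite mxE normrX.
  have /(congr1 Num.norm) := rootCK m0 (z 0 j).
  rewrite normrX z1 => /eqP; rewrite pexpr_eq1// => /eqP ->.
  by rewrite expr1n.
have [a' a'E] : exists a', pcl a' = f (r 1) by elim/PU_ind: (f (r 1)) => a'; exists a'.
have frX e : f (r e.+1) = pcl (a' ^+ e.+1)%g.
  elim: e => [|e IH]; first by rewrite expg1 a'E.
  rewrite (_ : r e.+2 = map2_mx *%R (r 1) (r e.+1)).
    by rewrite fM// IH -a'E pclM -expgS.
  by apply/rowP => j; rewrite !mxE expr1 -exprS.
have zr : z = r m by apply/rowP => j; rewrite mxE rootCK.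
have [l l1 al] : exists2 l : C, `|l| = 1 & umx a = l *: umx a' ^+ m.
  have : pcl a = pcl (a' ^+ m)%g by have := frX m.-1; rewrite prednK// -zr za.
  by move=> /pclE[l l1 ->]; exists l => //; rewrite umxX.
have [c c1 a'b] : exists2 c : C, `|c| = 1 & umx a' *m umx b = c *: (umx b *m umx a').
  apply/pcl_commute; rewrite a'E -wb /commute -!fM//; congr f.
  by apply/rowP => j; rewrite !mxE mulrC.
have cm := scalar_commutator_exp (umxP a') (umxP b) a'b.
rewrite /comm_mx al -scalemxAl -scalemxAr (scalar_commX m a'b) cm.
by rewrite scale1r.
Qed.

(** If the whole product has the centraliser property then so does its last
    factor, since 1 (x) u centralises the product as soon as u centralises the
    factor. *)
Lemma tens_set_centre m (T : set (PU R m)) ns : (0 < m)%N -> all (leq 2) ns ->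
  (forall u, u \is unitarymx -> (forall A, tens_set (lifts T) ns A -> comm_mx u A) ->
    tens_set (lifts T) ns u) ->
  forall u, u \is unitarymx -> (forall A, lifts T A -> comm_mx u A) -> lifts T u.
Proof.
move=> m0; elim: ns => [|k ns IH] //= /andP[k2 ns2] hZ; apply: IH => // u uu uS.
have k0 : (0 < k)%N by exact: ltnW.
have p0 : (0 < tens_dim m ns)%N.
  rewrite tens_dimE muln_gt0 m0 andbT; elim: ns ns2 {hZ u uu uS} => [|j ns IH /= /andP[j2 ns2]].
    by rewrite big_nil.
  by rewrite big_cons muln_gt0 IH// andbT; exact: ltnW.
have [|A [h [t [_ St ->]]]|h [t [Hh St]]] := hZ ((1%:M : 'M[C]_k) *t u).
- by apply/unitarymxP; rewrite adj_tens tensmx_mul trmx1 map_mx1 mulmx1 unitary_adjmxK// tens11.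
- by rewrite /comm_mx !tensmx_mul mul1mx mulmx1 uS.
move=> ut; rewrite -(lifts_tens_map T ns2) in St.
have tu := lifts_unitary St.
have : h *t (t *m u^t*) = 1%:M.
  rewrite -(tens11 R k (tens_dim m ns)) -(unitary_adjmxK uu).
  rewrite -[1%:M in RHS]mulmx1 -tensmx_mul ut tensmx_mul mulmx1 //.
move=> /(tens_scalar_factors k0 p0 (oner_neq0 _))[_ [c tuc]].
have c1 : `|c| = 1.
  have uau : u^t* \is unitarymx by rewrite trmxC_unitary.
  by apply: (unitary_scalar_norm p0); rewrite -tuc; exact: (mul_unitarymx tu uau).
have -> : u = c^-1 *: t.
  rewrite -[t]mulmx1 -(unitary_adjKmx uu) mulmxA tuc mul_scalar_mx scalerA.
  by rewrite mulVf ?scale1r// -normr_eq0 c1 oner_eq0.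
rewrite -(lifts_tens_map T ns2); apply: lifts_scale => //.
by rewrite normfV c1 invr1.
Qed.

End DiagonalTorus.

(** * Classification in the projective unitary group *)

(** Under the hypotheses of the uniqueness part the torus factor is a full
    conjugate of the diagonal torus, so that F is conjugate to a standard
    model depending on n and ns only. *)
Lemma decomposition_standard (R : realType) n ns (F : set (PU R n)) :
  (0 < n)%N -> admissible n ns -> is_subgroup F -> is_abelian F ->
  dim_fixed_eq_dim F -> has_decomposition ns F ->
  exists2 Q : 'M[Cplx R]_(n, tens_dim (n %/ \prod_(k <- ns) k) ns), isometric Q &
    lifts F = transport Q (tens_set diag_torus ns).
Proof.
move=> n0 [ns2 _ _ nsn] Fg Fab Fdim; rewrite /has_decomposition.
have m0 : (0 < n %/ \prod_(k <- ns) k)%N.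
  have p0 : (0 < \prod_(k <- ns) k)%N by exact: dvdn_gt0 nsn.
  by rewrite divn_gt0// dvdn_leq.
set m := (n %/ _)%N in m0 * => -[e [T [g [torT _ FT]]]].
have [G Gi FG] : exists2 G : 'M[Cplx R]_(n, tens_dim m ns), isometric G &
    lifts F = transport G (lifts [set tens_map x | x in HTprod ns T]).
  by apply/(transport_conj_set e); exists g; rewrite FT image_comp.
rewrite lifts_tens_map// in FG.
have [GG GG'] := Gi.
have hF := heis_lifts n0 Fg Fab Fdim.
have hT : heis (tens_set (lifts T) ns) n.
  have := heis_transport (isometric_adj Gi) hF.
  by rewrite FG -{2}[G]trmxCK transportK// trmxCK.
have [T1 TV TM] := group_divE (torus_subgroup torT).
have Tcomm := torus_lifts_commute m0 torT.
have hT' : heis (lifts T) 1.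
  split; first exact: lifts_unitary.
  - move=> _ _ [u <- Fu] [v <- Fv]; exists (u * v)%g => //.
    by rewrite -pclM; exact: TM.
  - by move=> _ [u <- Fu]; exists (u^-1)%g => //; rewrite -pclV; exact: TV.
  - move=> A B TA TB; exists 1; rewrite expr1n scale1r; split=> //; exact: Tcomm.
  - exact: tens_set_centre m0 ns2 (heisZ hT).
have [P [Pu TP]] := comm_heis_diag hT' Tcomm.
have {}TP : lifts T = transport (P^t*) diag_torus.
  rewrite TP; apply/seteqP; split=> [_ [d d1 <-]|_ [_ [d d1 <-] <-]].
    by exists (diag_mx d); [exists d|rewrite trmxCK].
  by exists d => //; rewrite trmxCK.
have [Q Qi TQ] := @tens_set_transport R _ _ diag_torus ns
  (isometric_adj ((isometric_unitary P).2 Pu)).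
exists (G *m Q); first exact: isometricM.
by rewrite transportM -TQ -TP.
Qed.

Theorem proposition2p1 (R : realType) (n : nat) (hn : (0 < n)%N) :
  (forall F : set (PU R n),
     closed_abelian_subgroup F -> dim_fixed_eq_dim F ->
     exists ns : seq nat, admissible n ns /\ has_decomposition ns F)
  /\
  (forall (ns : seq nat) (F1 F2 : set (PU R n)),
     admissible n ns ->
     closed_abelian_subgroup F1 -> dim_fixed_eq_dim F1 ->
     closed_abelian_subgroup F2 -> dim_fixed_eq_dim F2 ->
     has_decomposition ns F1 -> has_decomposition ns F2 ->
     exists g : PU R n, F2 = conj_set g F1).
Proof.
split=> [F [_ Fg Fab] Fdim|ns F1 F2 nsP [_ F1g F1ab] F1d [_ F2g F2ab] F2d D1 D2].
  have [ns [m [G [Gi FG ns2 _ nss]]]] := heis_structure hn hn (heis_lifts hn Fg Fab Fdim).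
  have [GG GG'] := Gi; have e := esym (isometry_square GG GG').
  have nE := tens_dimE m ns; rewrite e in nE.
  have p0 : (0 < \prod_(k <- ns) k)%N.
    by move: hn; rewrite nE muln_gt0 => /andP[].
  have m0 : (0 < m)%N by move: hn; rewrite nE muln_gt0 => /andP[].
  have mE : m = (n %/ \prod_(k <- ns) k)%N by rewrite nE mulKn.
  exists ns; split.
    split=> //; last by rewrite [X in (_ %| X)%N]nE dvdn_mulr.
    apply: (@sub_in_sorted _ (mem ns) _ geq _ ns (allss ns) nss) => a b ans _ ba.
    by apply: dvdn_leq => //; move/allP: ns2 => /(_ a ans)/ltnW.
  rewrite /has_decomposition; subst m; exists e, (@diag_PU R _).
  have [g gF] : exists g : PU R n, conj_set g F =
      [set castPU e z | z in [set tens_map x | x in HTprod ns (@diag_PU R _)]].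
    apply/transport_conj_set; exists G => //.
    by rewrite lifts_tens_map// lifts_diag_PU.
  exists g; split; [exact: diag_PU_torus| |by rewrite gF image_comp].
  move=> x y _ _; apply: tens_map_inj; move: hn; rewrite -[X in (_ < X)%N]e.
  by [].
have [Q1 Q1i F1Q] := decomposition_standard hn nsP F1g F1ab F1d D1.
have [Q2 Q2i F2Q] := decomposition_standard hn nsP F2g F2ab F2d D2.
have Qu : Q2 *m Q1^t* \is unitarymx.
  by apply/isometric_unitary/isometricM => //; exact: isometric_adj.
exists (pcl (Unitary Qu)); apply: lifts_inj; rewrite lifts_conj_set /=.
by rewrite F1Q transportM -{2}[Q1]trmxCK transportK// trmxCK; case: Q1i.
Qed.
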